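(* Let $G$ be a finite abelian group and let $\mathbb{F}$ be an algebraically closed field whose characteristic does not divide $|G|$. Write $G\cong C_{n_1}\oplus\dots\oplus C_{n_r}$ with $n_r\mid n_{r-1}\mid\dots\mid n_1$ and $n_r>1$, and put $\mathsf d^*(G)=\sum_{i=1}^r(n_i-1)$. Then \[\beta_{\mathrm{sep}}(G)\le \mathsf d^*(G)+1,\] with equality if and only if $G$ is cyclic or $2=n_{s+1}=\dots=n_r$, where $s$ is the integer with $r=2s-1$ or $r=2s$.
   Context: $C_n$ denotes the cyclic group of order $n$. A $G$-module is a finite dimensional $\mathbb{F}$-vector space $V$ with a linear action of $G$. $\mathcal{O}(V)$ is the coordinate ring of $V$ (a polynomial algebra with its standard grading), and $\mathcal{O}(V)^G=\{f\in\mathcal{O}(V): f(gv)=f(v)\ \forall v\in V, g\in G\}$ is the algebra of invariants. A subset $S\subset\mathcal{O}(V)^G$ is a separating set if whenever $v,w\in V$ satisfy $f(v)=f(w)$ for all $f\in S$, then $h(v)=h(w)$ for all $h\in\mathcal{O}(V)^G$. $\beta_{\mathrm{sep}}(G,V)$ is the minimal positive integer $d$ such that $\mathcal{O}(V)^G$ contains a separating set consisting of homogeneous elements of degree at most $d$, and $\beta_{\mathrm{sep}}(G)=\sup_V\beta_{\mathrm{sep}}(G,V)$, the supremum being over all $G$-modules $V$. The trivial group is the case $r=0$ and counts as cyclic. *)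

(* Defs.v *)
From HB Require Import structures.
From mathcomp Require Import all_boot all_order all_algebra all_fingroup.
From mathcomp Require Import all_solvable all_character.
From mathcomp Require Import mpoly.

Set Implicit Arguments.
Unset Strict Implicit.
Unset Printing Implicit Defensive.

Import GRing.Theory.
Local Open Scope ring_scope.

(* A G-module of dimension n is a representation rG : mx_representation F G n
   with G acting on the left of V = 'cV[F]_n by v |-> rG g *m v, and O(V) is
   {mpoly F[n]}, where 'X_i is the i-th coordinate function on V. *)

Section Separating.

Variables (F : fieldType) (gT : finGroupType) (G : {group gT}).

Definition pt_eval (n : nat) (f : {mpoly F[n]}) (v : 'cV[F]_n) : F :=
  f.@[fun i => v i 0].

Section Module.

Variables (n : nat) (rG : mx_representation F G n).

Definition invariant (f : {mpoly F[n]}) : Prop :=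
  forall (v : 'cV[F]_n) (g : gT), g \in G ->
    pt_eval f (rG g *m v) = pt_eval f v.

Definition separating_set (S : {mpoly F[n]} -> Prop) : Prop :=
  (forall f, S f -> invariant f) /\
  (forall v w : 'cV[F]_n,
     (forall f, S f -> pt_eval f v = pt_eval f w) ->
     forall h, invariant h -> pt_eval h v = pt_eval h w).

Definition separated_in_degree (d : nat) : Prop :=
  exists2 S : {mpoly F[n]} -> Prop, separating_set S &
    forall f, S f -> exists2 e, (e <= d)%N & f \is e.-homog.

(* d = beta_sep(G, V) *)
Definition is_beta_sep_module (d : nat) : Prop :=
  [/\ (0 < d)%N, separated_in_degree d &
      forall e, (0 < e)%N -> separated_in_degree e -> (d <= e)%N].

End Module.

Definition beta_sep_ubound (b : nat) : Prop :=
  forall (n : nat) (rG : mx_representation F G n),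
    exists2 d, is_beta_sep_module rG d & (d <= b)%N.

(* b = beta_sep(G); in particular the supremum is finite *)
Definition is_beta_sep (b : nat) : Prop :=
  beta_sep_ubound b /\ forall c, beta_sep_ubound c -> (b <= c)%N.

Lemma is_beta_sep_uniq (b c : nat) : is_beta_sep b -> is_beta_sep c -> b = c.
Proof.
by move=> [ub minb] [uc minc]; apply/eqP; rewrite eqn_leq minb ?minc.
Qed.

End Separating.

Arguments is_beta_sep F {gT} G b.

Definition dstar (r : nat) (m : 'I_r -> nat) : nat := (\sum_(i < r) (m i - 1))%N.

(* Main.v *)
(* Invariants of a diagonalized module are spanned by the monomials of trivial
   weight, so degree [d] separates as soon as, for every family of characters,
   the lattice [L] of integer relations is generated by the nonnegative relations
   of length at most [d] (on each support).  The Hermite normal form of [L] has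
   rows of length at most [1 + sum (c_x - 1)], where [c_x] is the order of a
   character modulo the later ones; since the product of any [k] of the [c_x] is
   at most [n_1 ... n_k], majorization bounds this by [d* + 1].  If [d*] fails
   for a minimal family, every ordering of the family is extremal: there are
   [r + 1] characters, one more than the rank, all coordinates of a relation have
   the same parity, the odd relations being the long ones.  Comparing odd
   relations then pairs each [x] of a tail carrying all [c_x > 2] with some [y]
   outside that tail with [2 x = 2 y], so that [2 #{i | n_i > 2} <= r + 1].
   Conversely [e_i, e_i + f_i] with [f_i] generating the 2-torsion summands gives
   equality. *)
From Stdlib Require Import Classical.
From HB Require Import structures.
Require Import Defs.
From mathcomp Require Import all_boot all_order all_algebra all_fingroup.
From mathcomp Require Import all_solvable all_character.
From mathcomp Require Import separable cyclotomic mpoly zify lra.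

Set Implicit Arguments.
Unset Strict Implicit.
Unset Printing Implicit Defensive.

Import Order.TTheory GRing.Theory Num.Theory.
Local Open Scope ring_scope.

(** * Majorization *)

(** Two points with the same nonzero coordinates agree on a monomial exactly when the corresponding
    product of powers of their coordinate ratios is 1. The exponents with this property form a
    subgroup, so generation is tested against an arbitrary predicate [H] closed under subtraction.
    Vanishing coordinates are the reason for treating each support [e] separately. The ordering of
    the family is free, and this freedom drives the equality case. A relation outside [H] must be
    longer than [d*], while prescribing a few coordinates and completing the rest economically gives
    a relation that is hardly longer. The completion is then forced to be the extremal one, and
    comparing two forced relations yields an identity such as [g x = g y] or [2 g i = 2 g y]. Twice
    a minimal relation always lies in [H], so on a minimal family [H] has index 2 among the
    relations; this is the source of the parity and of the special role of summands of order 2. *)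

Lemma sum_ge_of_prod_ge1 (R : realFieldType) (l : nat) (x : nat -> R) :
  (forall i, (i < l)%N -> 0 <= x i) -> 1 <= \prod_(i < l) x i ->
  l%:R <= \sum_(i < l) x i ?= iff [forall i : 'I_l, x i == 1].
Proof.
move=> x0 px; case: l => [|l] in x0 px *.
  by rewrite big_ord0; split=> //; rewrite eqxx; apply/esym/forallP; case.
have x0' : {in 'I_l.+1, forall i : 'I_l.+1, 0 <= x i} by move=> i _; apply: x0.
have := leif_AGM x0'; rewrite card_ord.
set mu := _ / _ => -[le_mu eq_mu].
have sumE : \sum_(i < l.+1) x i = mu * l.+1%:R by rewrite divfK ?pnatr_eq0.
have mu_ge0 : 0 <= mu by rewrite divr_ge0 ?sumr_ge0 // => i _; apply: x0.
have mu_ge1 : 1 <= mu.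
  by rewrite -(ler_pXn2r (n := l.+1)) ?nnegrE // expr1n (le_trans px).
split; first by rewrite sumE ler_peMl ?ler0n.
apply/eqP/forallP => [|x1]; last first.
  by rewrite (eq_bigr _ (fun i _ => eqP (x1 i))) sumr_const card_ord.
rewrite sumE -[l.+1%:R in LHS]mul1r => /(mulIf _) mu1.
have {}mu1 : mu = 1 by rewrite -mu1 ?pnatr_eq0.
(* With mean 1, AM-GM bounds the product by 1, so the product is 1; the equality case then makes all
   [x i] equal, hence equal to the mean. *)
move: eq_mu; rewrite mu1 expr1n eq_le px andbT.
rewrite mu1 expr1n in le_mu; rewrite le_mu => /esym/forall_inP xE i.
have : \sum_(j < l.+1) x j = x i * l.+1%:R.
  rewrite mulr_natr -[in X in _ *+ X](card_ord l.+1) -sumr_const.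
  by apply: eq_bigr => j _; have /forall_inP/(_ i isT)/eqP := xE j isT.
by rewrite sumE mu1 => /(mulIf _) <-; rewrite ?pnatr_eq0.
Qed.

(* Abel summation reduces the weighted inequality to AM-GM on the prefixes of
   the sequence of ratios [n i / c i]. *)
Lemma leq_sum_prefix_prod (c n : nat -> nat) (M : nat) :
    (forall i, 0 < c i)%N -> (forall i, c i.+1 <= c i)%N ->
    (forall l, l <= M -> \prod_(i < l) c i <= \prod_(i < l) n i)%N ->
  (\sum_(i < M) c i <= \sum_(i < M) n i)%N /\
  (\sum_(i < M) c i = \sum_(i < M) n i -> forall i, i < M -> c i = n i)%N.
Proof.
move=> c_gt0 c_dec prefix.
pose x i : rat := (n i)%:R / (c i)%:R.
have c0 i : (c i)%:R != 0 :> rat by rewrite pnatr_eq0 -lt0n.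
have x0 i : 0 <= x i by rewrite divr_ge0.
have AM l : (l <= M)%N ->
    l%:R <= \sum_(i < l) x i ?= iff [forall i : 'I_l, x i == 1].
  move=> lM; apply: sum_ge_of_prod_ge1 => [i _|]; first exact: x0.
  rewrite prodf_div ler_pdivlMr ?mul1r; last first.
    by rewrite prodr_gt0 // => i _; rewrite ltr0n.
  by rewrite -!natr_prod ler_nat prefix.
have xc i : (n i)%:R = (c i)%:R * x i by rewrite mulrC divfK.
have abel l : (l.+1 <= M)%N ->
    (c l)%:R * (\sum_(i < l.+1) x i - l.+1%:R) <=
    (\sum_(i < l.+1) n i)%:R - (\sum_(i < l.+1) c i)%:R.
  elim: l => [|l IHl] lM.
    by rewrite !big_ord1 xc mulrBr mulr1.
  rewrite !(big_ord_recr l.+1) /= !natrD xc.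
  set S := \sum_(i < l.+1) x i in IHl *.
  have S0 : 0 <= S - l.+1%:R by rewrite subr_ge0; case: (AM l.+1 (ltnW lM)).
  have := IHl (ltnW lM).
  (* The prefix surplus [S - (l + 1)] is nonnegative, so its weight may be lowered from [c l] to
     [c l.+1]; this is where monotonicity of [c] enters. *)
  have : (c l.+1)%:R * (S - l.+1%:R) <= (c l)%:R * (S - l.+1%:R).
    by rewrite ler_wpM2r // ler_nat c_dec.
  rewrite -[l.+2]addn1 natrD; lra.
case: M => [|M] in prefix AM abel *; first by rewrite !big_ord0; split=> // _ [].
have [AM1 AM2] := AM M.+1 (leqnn _); have := abel M (leqnn _).
set S := \sum_(i < M.+1) x i in AM1 AM2 *.
have S0 : 0 <= S - M.+1%:R by rewrite subr_ge0.
move=> leS; split.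
  by rewrite -(ler_nat rat) -subr_ge0 (le_trans _ leS) // mulr_ge0.
move=> eq_cn; move: leS; rewrite eq_cn subrr pmulr_rle0 ?ltr0n // => S0'.
have /eqP : S - M.+1%:R = 0 by apply/eqP; rewrite eq_le S0 S0'.
rewrite subr_eq0 eq_sym AM2 => /forallP x1 i iM.
have /eqP xi := x1 (Ordinal iM).
by have /eqP := xc i; rewrite xi mulr1 eqr_nat => /eqP.
Qed.

(** A prefix of the decreasing rearrangement of [c] is, up to permutation, a subsequence of [c], so
    the hypothesis yields the prefix condition of [leq_sum_prefix_prod]. Both sequences are padded
    with ones to a common length; ones affect neither the sums of [x - 1] nor the filter. *)
Lemma majorization (c : seq nat) (n : nat -> nat) (r : nat) :
    all (leq 1) c -> (forall i, i < r -> 1 < n i)%N ->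
    (forall i, r <= i -> n i = 1)%N ->
    (forall s, subseq s c -> \prod_(x <- s) x <= \prod_(i < size s) n i)%N ->
  (\sum_(x <- c) (x - 1) <= \sum_(i < r) (n i - 1))%N /\
  (\sum_(x <- c) (x - 1) = \sum_(i < r) (n i - 1) ->
   perm_eq [seq x <- c | 1 < x] (mkseq n r))%N.
Proof.
move=> c_gt0 n_gt1 n_eq1 prefix.
have n_gt0 i : (0 < n i)%N by case: (ltnP i r) => [/n_gt1/ltnW|/n_eq1->].
pose s := sort geq c; pose f i := nth 1%N s i; pose M := (size s + r)%N.
have s_c : perm_eq s c by rewrite perm_sort.
have s_gt0 : all (leq 1) s by rewrite (perm_all _ s_c).
have f_gt0 i : (0 < f i)%N.
  by rewrite /f; case: (ltnP i (size s)) => [/(all_nthP 1%N s_gt0)|/(nth_default _)->].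
have f_dec i : (f i.+1 <= f i)%N.
  case: (ltnP i.+1 (size s)) => [ltis|/(nth_default 1%N)]; last by rewrite /f => ->.
  have sS : sorted geq s by apply: sort_sorted => a b; apply: leq_total.
  by apply: (sorted_leq_nth (rev_trans leq_trans) leqnn 1%N sS);
     rewrite ?inE ?(ltnW ltis).
have mkf : s ++ nseq r 1%N = mkseq f M.
  apply: (@eq_from_nth _ 1%N) => [|i]; rewrite size_cat size_nseq ?size_mkseq // => iM.
  rewrite nth_mkseq // nth_cat /f; case: ltnP => // si.
  by rewrite nth_nseq if_same nth_default.
have prefix_f l : (\prod_(i < l) f i <= \prod_(i < l) n i)%N.
  have [s' s'c tk] : exists2 s', subseq s' c & perm_eq (take l s) s'.
    apply/count_subseqP => x; rewrite -(seq.permP s_c).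
    by rewrite -{2}(cat_take_drop l s) count_cat leq_addr.
  have -> : (\prod_(i < l) f i = \prod_(x <- s') x)%N.
    rewrite -(perm_big _ tk) /= (big_nth 1%N) big_mkord size_take_min.
    rewrite [RHS](eq_bigr (fun i : 'I_(minn l (size s)) => f i)); last first.
      by move=> i _; rewrite nth_take // (leq_trans (ltn_ord i)) ?geq_minl.
    rewrite -!(big_mkord xpredT f) (big_cat_nat (leq0n _) (geq_minl l (size s))) /=.
    rewrite [X in (_ * X)%N]big_nat_cond [X in (_ * X)%N]big1 ?muln1 // => i.
    by rewrite andbT geq_min => /andP[/orP[|/(nth_default 1%N)//] li /(leq_trans)/(_ li)];
       rewrite ltnn.
  apply: leq_trans (prefix _ s'c) _.
  have le_l : (size s' <= l)%N by rewrite -(perm_size tk) size_take_min geq_minl.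
  rewrite -!(big_mkord xpredT n) (big_cat_nat (leq0n _) le_l) /=.
  by rewrite leq_pmulr // prodn_gt0.
have sum1 (h : nat -> nat) l : (forall i, 0 < h i)%N ->
    (\sum_(i < l) h i = \sum_(i < l) (h i - 1) + l)%N.
  move=> h0; rewrite -[X in (_ + X)%N](card_ord l) -sum1_card -big_split /=.
  by apply: eq_bigr => i _; rewrite subnK.
have sum_c : (\sum_(x <- c) (x - 1) = \sum_(i < M) (f i - 1))%N.
  rewrite -(perm_big _ s_c) -[RHS](big_mkord xpredT (fun i => f i - 1)%N).
  have -> : index_iota 0 M = iota 0 M by rewrite /index_iota subn0.
  rewrite -(big_map f xpredT (fun x => x - 1)%N) /= -/(mkseq f M) -mkf big_cat /=.
  by rewrite [X in (_ + X)%N]big1_seq ?addn0 // => i /=; rewrite mem_nseq => /andP[_ /eqP->].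
have sum_n : (\sum_(i < r) (n i - 1) = \sum_(i < M) (n i - 1))%N.
  rewrite -!(big_mkord xpredT (fun i => n i - 1)%N).
  rewrite [RHS](big_cat_nat (leq0n _) (leq_addl (size s) r)) /=.
  rewrite [X in (_ + X)%N]big_nat_cond [X in (_ + X)%N]big1 ?addn0 // => i.
  by rewrite andbT => /andP[/n_eq1-> _].
have [le1 eq1] := leq_sum_prefix_prod f_gt0 f_dec (fun l _ => prefix_f l) (M := M).
rewrite sum_c sum_n; split; first by move: le1; rewrite !sum1 // leq_add2r.
move=> eq2; have {}eq1 : forall i, (i < M)%N -> f i = n i.
  by apply: eq1; rewrite !sum1 // eq2.
rewrite -(permPl (perm_filter _ s_c)) (_ : mkseq n r = [seq x <- s | 1 < x]%N) //.
have : [seq x <- mkseq n M | 1 < x]%N = [seq x <- s ++ nseq r 1%N | 1 < x]%N.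
  by rewrite mkf; congr filter; apply/eq_in_map => i; rewrite mem_iota => /eq1.
rewrite filter_cat (_ : [seq x <- nseq r 1 | 1 < x]%N = [::]) ?cats0; last first.
  apply/eqP; rewrite -(negbK (_ == _)) -has_filter; apply/hasPn => x.
  by rewrite mem_nseq => /andP[_ /eqP->].
move=> <-; rewrite /mkseq /M addnC iotaD map_cat filter_cat add0n.
rewrite (_ : [seq x <- map n (iota r _) | 1 < x]%N = [::]) ?cats0; last first.
  apply/eqP; rewrite -(negbK (_ == _)) -has_filter; apply/hasPn => x.
  by case/mapP => i; rewrite mem_iota => /andP[/n_eq1 ni _] ->; rewrite ni.
apply/esym/all_filterP/allP => x /mapP[i]; rewrite mem_iota add0n => /andP[_ ir] ->.
exact: n_gt1.
Qed.

(** * Relations in a finite abelian group *)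

Section Relations.

Variables (A : finZmodType) (T : finType) (g : T -> A).

Implicit Types (a b : {ffun T -> int}) (e t p : seq T) (x y : T) (z : A).

Definition val_at a : A := \sum_i g i *~ a i.
Definition basis_vec x : {ffun T -> int} := [ffun i => (i == x)%:R].
Definition vec_len a : int := \sum_i a i.
Definition nonneg_vec a := forall i, 0 <= a i.
Definition supported e a := forall i, i \notin e -> a i = 0.
Definition relation_on e a := supported e a /\ val_at a = 0.
Definition span e : {set A} := <<[set g i | i in e]>>%g.

Lemma val_atB : {morph val_at : a b / a - b}.
Proof.
by move=> a b; rewrite -sumrB; apply: eq_bigr => i _; rewrite !ffunE mulrzBr.
Qed.
HB.instance Definition _ := GRing.isZmodMorphism.Build _ _ val_at val_atB.

Lemma vec_lenB : {morph vec_len : a b / a - b}.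
Proof. by move=> a b; rewrite -sumrB; apply: eq_bigr => i _; rewrite !ffunE. Qed.
HB.instance Definition _ := GRing.isZmodMorphism.Build _ _ vec_len vec_lenB.

Lemma vec_lenD a b : vec_len (a + b) = vec_len a + vec_len b.
Proof. exact: raddfD. Qed.

Lemma val_at_basis x : val_at (basis_vec x) = g x.
Proof.
rewrite /val_at (bigD1 x) //= ffunE eqxx mulr1z big1 ?addr0 // => i /negPf ix.
by rewrite ffunE ix mulr0z.
Qed.

Lemma vec_len_basis x : vec_len (basis_vec x) = 1.
Proof.
by rewrite /vec_len (bigD1 x) //= ffunE eqxx big1 ?addr0 // => i /negPf ix; rewrite ffunE ix.
Qed.

Lemma ffun_mulrnE a k i : (a *+ k) i = a i *+ k.
Proof. by elim: k => [|k IH]; rewrite ?mulr0n ?mulrS !ffunE ?IH. Qed.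

Lemma ffun_mulrzE a (k : int) i : (a *~ k) i = a i *~ k.
Proof. by case: k => k; rewrite /= ?NegzE ?mulrNz ?ffunE -?pmulrn ffun_mulrnE. Qed.

Lemma supportedB e a b : supported e a -> supported e b -> supported e (a - b).
Proof. by move=> sa sb i ie; rewrite !ffunE sa ?sb. Qed.

Lemma supportedD e a b : supported e a -> supported e b -> supported e (a + b).
Proof. by move=> sa sb i ie; rewrite !ffunE sa ?sb. Qed.

Lemma supportedMz e a k : supported e a -> supported e (a *~ k).
Proof. by move=> sa i ie; rewrite ffun_mulrzE sa ?mul0rz. Qed.

Lemma supported_basis e x : x \in e -> supported e (basis_vec x).
Proof. by move=> xe i; rewrite ffunE; case: eqP => // -> /negP. Qed.

Lemma supportedS e e' a : {subset e <= e'} -> supported e a -> supported e' a.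
Proof. by move=> ee sa i ie; apply: sa; apply: contra ie; apply: ee. Qed.

Lemma relation_onB e a b : relation_on e a -> relation_on e b -> relation_on e (a - b).
Proof. by case=> sa va [sb vb]; split; [apply: supportedB | rewrite raddfB /= va vb subrr]. Qed.

Lemma relation_onMz e a k : relation_on e a -> relation_on e (a *~ k).
Proof. by case=> sa va; split; [apply: supportedMz | rewrite raddfMz /= va mul0rz]. Qed.

Lemma relation_onS e e' a : {subset e <= e'} -> relation_on e a -> relation_on e' a.
Proof. by move=> ee [/(supportedS ee)]. Qed.

Lemma relation_on_behead x t a : x \notin t ->
  relation_on (x :: t) a -> a x = 0 -> relation_on t a.
Proof.
move=> xt [sa va] ax; split=> // i it; have [->//|ix] := eqVneq i x.
by apply: sa; rewrite inE negb_or ix.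
Qed.

Lemma span0 e : 0 \in span e. Proof. exact: group1. Qed.

Lemma spanD e z z' : z \in span e -> z' \in span e -> z + z' \in span e.
Proof. exact: groupM. Qed.

Lemma spanN e z : (- z \in span e) = (z \in span e).
Proof. exact: groupV. Qed.

Lemma spanB e z z' : z \in span e -> z' \in span e -> z - z' \in span e.
Proof. by move=> ze z'e; rewrite spanD ?spanN. Qed.

Lemma spanMn e z k : z \in span e -> z *+ k \in span e.
Proof. exact: groupX. Qed.

Lemma spanMz e z (k : int) : z \in span e -> z *~ k \in span e.
Proof. by move=> ze; case: k => k; rewrite /= ?NegzE ?mulrNz ?spanN -pmulrn spanMn. Qed.

Lemma mem_span e x : x \in e -> g x \in span e.
Proof. by move=> xe; apply: mem_gen; apply: imset_f. Qed.

Lemma spanS e e' : {subset e <= e'} -> span e \subset span e'.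
Proof. by move=> ee; apply/genS/imsetS/subsetP. Qed.

Lemma eq_span e e' : e =i e' -> span e = span e'.
Proof. by move=> ee; apply/eqP; rewrite eqEsubset !spanS // => i; rewrite ee. Qed.

Lemma val_at_span e a : supported e a -> val_at a \in span e.
Proof.
move=> sa; rewrite /val_at; elim/big_ind: _ => [|u v|i _]; [exact: span0|exact: spanD|].
by case: (boolP (i \in e)) => [ie|/sa->]; rewrite ?span0 // spanMz ?mem_span.
Qed.

Lemma spanP e z : reflect (exists2 a, supported e a & val_at a = z) (z \in span e).
Proof.
apply: (iffP idP) => [/gen_prodgP[k [c ce ->]]|[a sa <-]]; last exact: val_at_span.
elim: k c ce => [|k IHk] c ce.
  exists 0; first by move=> i; rewrite ffunE.
  by rewrite big_ord0 raddf0.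
have [a sa va] := IHk (fun i => c (lift ord0 i)) (fun i => ce _).
have /imsetP[x xe cx] := ce ord0.
exists (basis_vec x + a); first by apply: supportedD => //; apply: supported_basis.
by rewrite raddfD /= va val_at_basis big_ord_recl cx.
Qed.

Lemma relative_order_subproof x t : exists k, (0 < k)%N && (g x *+ k \in span t).
Proof.
exists #[g x : FinRing.Zmodule_to_finGroup A]%g; rewrite order_gt0 /=.
have := expg_order (g x : FinRing.Zmodule_to_finGroup A).
by rewrite FinRing.zmodXgE => ->; apply: span0.
Qed.

(** The order of [g x] modulo [span t], which is the pivot at [x] in the Hermite normal form of the
    relations on [x :: t]. *)
Definition relative_order x t := ex_minn (relative_order_subproof x t).

Lemma relative_order_gt0 x t : (0 < relative_order x t)%N.
Proof. by rewrite /relative_order; case: ex_minnP => k /andP[]. Qed.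

Lemma mulrn_relative_order x t : g x *+ relative_order x t \in span t.
Proof. by rewrite /relative_order; case: ex_minnP => k /andP[]. Qed.

Lemma relative_order_dvd x t (k : int) :
  (g x *~ k \in span t) = (relative_order x t %| k)%Z.
Proof.
set c := relative_order x t; have c_gt0 : (0 < c)%N := relative_order_gt0 x t.
have gc q : g x *~ (q * c%:Z) \in span t.
  by rewrite mulrC mulrzA spanMz // -pmulrn mulrn_relative_order.
apply/idP/dvdzP => [kt|[q ->]//].
exists (k %/ c)%Z; rewrite {1}(divz_eq k c); set m := (k %% c)%Z.
have m_ge0 : 0 <= m by rewrite modz_ge0; lia.
have m_lt : m < c by rewrite ltz_pmod; lia.
have : g x *~ m \in span t.
  have -> : m = k - (k %/ c)%Z * c by rewrite {1}(divz_eq k c) addrC addKr.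
  by rewrite mulrzBr spanB.
case: (m) m_ge0 m_lt => // m' _ m'_lt; rewrite -pmulrn => m't.
suff -> : m' = 0%N by rewrite addr0.
apply/eqP; rewrite -leqn0 leqNgt; apply/negP => m'_gt0.
move: (m'_lt); rewrite /c /relative_order; case: ex_minnP => k' _ /(_ m').
by rewrite m'_gt0 m't => /(_ isT); lia.
Qed.

Lemma relative_order_dvdn x t (k : nat) :
  (g x *+ k \in span t) = (relative_order x t %| k)%N.
Proof. by rewrite pmulrn relative_order_dvd. Qed.

Lemma eq_relative_order x t t' : t =i t' -> relative_order x t = relative_order x t'.
Proof.
move=> tt; have tt' := eq_span tt.
apply/eqP; rewrite eqn_dvd -!relative_order_dvdn {1}tt' mulrn_relative_order.
by rewrite -tt' mulrn_relative_order.
Qed.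

Lemma leq_relative_order x t t' : {subset t <= t'} ->
  (relative_order x t' <= relative_order x t)%N.
Proof.
move=> tt; apply: dvdn_leq; rewrite ?relative_order_gt0 // -relative_order_dvdn.
by rewrite (subsetP (spanS tt)) ?mulrn_relative_order.
Qed.

(** The multiples of [g x] by [0, ..., c - 1] lie in distinct cosets of [span t]. *)
Lemma card_span_cons x t : (relative_order x t * #|span t| <= #|span (x :: t)|)%N.
Proof.
set c := relative_order x t.
pose f (u : 'I_c * A) := g x *+ u.1 + u.2.
rewrite -[c in (c * _)%N]card_ord -cardsT -cardsX -(card_in_imset (f := f)).
  apply/subset_leq_card/subsetP => _ /imsetP[[k z] /setXP[_ zt] ->].
  rewrite spanD ?spanMn ?mem_span ?mem_head //=.
  by apply: subsetP zt; apply: spanS => i; rewrite inE orbC => ->.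
move=> [k z] [k' z'] /setXP[_ /= zt] /setXP[_ /= z't]; rewrite /f /= => E.
have : g x *~ (k%:Z - k'%:Z) \in span t.
  rewrite mulrzBr -!pmulrn (_ : _ - _ = z' - z) ?spanB //.
  by apply/eqP; rewrite subr_eq addrAC -subr_eq opprK E addrC.
rewrite relative_order_dvd -/c => dvd_c.
suff kk : k = k' by move: E; rewrite kk => /addrI->.
apply/val_inj/eqP => /=; have := ltn_ord k; have := ltn_ord k'.
case/dvdzP: dvd_c => q; case: q => [[|q]|q]; nia.
Qed.

Fixpoint relative_orders e : seq nat :=
  if e is x :: t then relative_order x t :: relative_orders t else [::].

Definition excess e : nat := \sum_(c <- relative_orders e) (c - 1).

(** In the mixed radix system whose bases are the relative orders, this is the vector with all
    digits maximal; its length is [excess e]. *)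
Fixpoint top_vec e : {ffun T -> int} :=
  if e is x :: t then basis_vec x *+ (relative_order x t - 1) + top_vec t else 0.

Lemma size_relative_orders e : size (relative_orders e) = size e.
Proof. by elim: e => //= x t ->. Qed.

Lemma excess_cons x t : excess (x :: t) = (relative_order x t - 1 + excess t)%N.
Proof. by rewrite /excess big_cons. Qed.

(** Deleting elements from a tail can only increase relative orders, so the selected ones are
    bounded by the relative orders computed inside the selection. *)
Lemma prod_mask_relative_orders e m :
  (\prod_(c <- mask m (relative_orders e)) c <= #|span (mask m e)|)%N.
Proof.
elim: e m => [|x t IHe] [|[] m] /=; rewrite ?big_nil ?cardG_gt0 ?IHe //.
rewrite big_cons (leq_trans _ (card_span_cons _ _)) // leq_mul ?IHe //.
exact/leq_relative_order/mem_subseq/mask_subseq.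
Qed.

Lemma supported_top e : supported e (top_vec e).
Proof.
elim: e => [|x t IHt] i /=; rewrite ?ffunE // inE negb_or => /andP[/negPf ix it].
by rewrite ffun_mulrnE ffunE ix mul0rn IHt.
Qed.

Lemma top_cat_at e y t : uniq (e ++ y :: t) ->
  top_vec (e ++ y :: t) y = (relative_order y t - 1)%N.
Proof.
elim: e => [|x e IHe] /=.
  by case/andP=> yt _; rewrite !ffunE ffun_mulrnE ffunE eqxx supported_top ?addr0 ?natz.
case/andP=> xe /IHe; rewrite !ffunE ffun_mulrnE ffunE => ->.
case: eqP => [yx|_]; last by rewrite mul0rn add0r.
by rewrite -yx mem_cat mem_head orbT in xe.
Qed.

Lemma span_consP x t z : z \in span (x :: t) ->
  exists2 k, (k < relative_order x t)%N & z - g x *+ k \in span t.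
Proof.
set c := relative_order x t; have c_gt0 : (0 < c)%N := relative_order_gt0 x t.
case/spanP=> a sa <-; set m := (a x %% c)%Z.
have m_ge0 : 0 <= m by rewrite modz_ge0; lia.
have m_lt : m < c by rewrite ltz_pmod; lia.
case m_k: m m_ge0 m_lt => [k|//] _ k_lt; exists k; first lia.
have -> : val_at a - g x *+ k =
    val_at (a - basis_vec x *~ a x) + g x *~ (a x - k%:Z).
  rewrite raddfB raddfMz /= val_at_basis mulrzBr -pmulrn.
  by rewrite addrA subrK.
apply: spanD.
  have [xt|xt] := boolP (x \in t).
    apply: val_at_span; apply: (@supportedS (x :: t)) => [i|].
      by rewrite inE => /orP[/eqP->|].
    by apply: supportedB => //; apply/supportedMz/supported_basis/mem_head.
  apply: val_at_span => i it; rewrite !ffunE ffun_mulrzE ffunE.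
  have [->|ix] := eqVneq i x; first by rewrite mulr1n intz subrr.
  by rewrite mul0rz subr0 sa // inE negb_or ix.
rewrite relative_order_dvd -/c -m_k /m; apply/dvdzP.
by exists (a x %/ c)%Z; rewrite {1}(divz_eq (a x) c) addrK.
Qed.

(** Mixed radix expansion: the head coefficient is reduced below its relative order and the
    remainder is expanded in the tail. The last clause, rigidity at maximal length, is what every
    later comparison of relations rests on. *)
Lemma span_rep e z : z \in span e ->
  exists a, [/\ supported e a, nonneg_vec a, val_at a = z,
                vec_len a <= excess e & vec_len a = excess e -> a = top_vec e].
Proof.
elim: e z => [|x t IHt] z.
  case/spanP=> a sa <-; have -> : a = 0 by apply/ffunP => i; rewrite ffunE sa.
  exists 0; rewrite !raddf0 /excess big_nil.
  by split=> // i; rewrite ffunE.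
case/span_consP=> k k_lt /IHt[a [sa na va la ea]].
exists (basis_vec x *+ k + a); rewrite !raddfD !raddfMn /= va vec_len_basis val_at_basis.
rewrite excess_cons PoszD natz; split.
- apply: supportedD; last by apply: supportedS sa => i; rewrite inE orbC => ->.
  by rewrite pmulrn; apply/supportedMz/supported_basis/mem_head.
- by move=> i; rewrite ffunE addr_ge0 // ffun_mulrnE ffunE mulrn_wge0.
- by rewrite addrC subrK.
- by lia.
- by move=> E; rewrite -ea; [congr (_ *+ _ + _); lia | lia].
Qed.

End Relations.

(** * Short generators of the lattice of relations *)

Section ShortRelations.

Variables (A : finZmodType) (T : finType) (g : T -> A) (n : nat -> nat) (r : nat).

Hypothesis n_gt1 : forall i, (i < r)%N -> (1 < n i)%N.
Hypothesis n_eq1 : forall i, (r <= i)%N -> n i = 1%N.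
Hypothesis card_span :
  forall e, uniq e -> (#|span g e| <= \prod_(i < size e) n i)%N.

Let dst : nat := \sum_(i < r) (n i - 1).

Implicit Types (a b : {ffun T -> int}) (e t p : seq T) (x y : T).

Lemma relative_orders_gt0 e : all (leq 1) (relative_orders g e).
Proof. by elim: e => //= x t ->; rewrite relative_order_gt0. Qed.

Lemma excess_dstar e : uniq e ->
  (excess g e <= dst)%N /\
  (excess g e = dst -> perm_eq [seq c <- relative_orders g e | 1 < c]%N (mkseq n r)).
Proof.
move=> e_uniq; apply: majorization => //; first exact: relative_orders_gt0.
move=> s /subseqP[m sm ->]; rewrite size_relative_orders in sm.
apply: leq_trans (prod_mask_relative_orders g e m) _.
apply: leq_trans (card_span (mask_uniq e_uniq _)) _.
by rewrite !size_mask ?size_relative_orders.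
Qed.

Variable H : {ffun T -> int} -> Prop.
Hypothesis H0 : H 0.
Hypothesis HB : forall a b, H a -> H b -> H (a - b).

Lemma closedN a : H a -> H (- a).
Proof. by rewrite -sub0r; apply: HB. Qed.

Lemma closedD a b : H a -> H b -> H (a + b).
Proof. by move=> Ha Hb; rewrite -[b]opprK; apply: HB => //; apply: closedN. Qed.

Lemma closedMz a (k : int) : H a -> H (a *~ k).
Proof.
have closedMn c l : H c -> H (c *+ l).
  by move=> Hc; elim: l => [|l IHl]; rewrite ?mulr0n // mulrS; apply: closedD.
by move=> Ha; case: k => k; rewrite ?NegzE ?mulrNz -pmulrn; [|apply: closedN]; apply: closedMn.
Qed.

Lemma relation_head x t a : relation_on g (x :: t) a ->
  exists q : int, a x = q * (relative_order g x t : int).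
Proof.
case=> sa va; apply/dvdzP; rewrite -relative_order_dvd.
have [xt|xt] := boolP (x \in t); first by rewrite spanMz ?mem_span.
have -> : g x *~ a x = - val_at g (a - basis_vec x *~ a x).
  by rewrite raddfB raddfMz /= val_at_basis va sub0r opprK.
rewrite spanN; apply: val_at_span => i it; rewrite !ffunE ffun_mulrzE ffunE.
have [->|ix] := eqVneq i x; first by rewrite mulr1n intz subrr.
by rewrite mul0rz subr0 sa // inE negb_or ix.
Qed.

(** One step of elimination: a multiple of a row with the exact pivot at [x] clears that coordinate
    and leaves a relation on [t]. *)
Lemma generated_of_head x t a b : x \notin t ->
    (forall c, relation_on g t c -> H c) ->
    relation_on g (x :: t) a -> relation_on g (x :: t) b ->
    b x = relative_order g x t -> H b -> H a.
Proof.
move=> xt Ht ra rb bx Hb; have [q aq] := relation_head ra.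
rewrite -(subrK (b *~ q) a); apply: closedD; last exact: closedMz.
apply/Ht/(relation_on_behead xt); first by apply: relation_onB => //; apply: relation_onMz.
by rewrite !ffunE ffun_mulrzE bx aq -mulrzl intz subrr.
Qed.

(** The Hermite row with pivot at [x], made nonnegative by taking for its tail the mixed radix
    expansion of minus the pivot times [g x]. *)
Lemma head_relation x t :
  exists b, [/\ relation_on g (x :: t) (basis_vec x *+ relative_order g x t + b),
    supported t b, nonneg_vec b, vec_len b <= excess g t
    & vec_len b = excess g t -> b = top_vec g t].
Proof.
have /span_rep[b [sb nb vb lb eb]] : - (g x *+ relative_order g x t) \in span g t.
  by rewrite spanN mulrn_relative_order.
exists b; split=> //; split.
  apply: supportedD; last by apply: supportedS sb => i; rewrite inE orbC => ->.
  by rewrite pmulrn; apply/supportedMz/supported_basis/mem_head.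
by rewrite raddfD raddfMn /= val_at_basis vb subrr.
Qed.

Lemma nonneg_basis_head x (k : nat) b : nonneg_vec b -> nonneg_vec (basis_vec x *+ k + b).
Proof. by move=> nb i; rewrite ffunE addr_ge0 // ffun_mulrnE ffunE mulrn_wge0. Qed.

Lemma vec_len_basis_head x (k : nat) b :
  vec_len (basis_vec x *+ k + b) = k%:Z + vec_len b.
Proof. by rewrite raddfD raddfMn /= vec_len_basis natz. Qed.

(* The rows [c_x e_x + ...] of the Hermite normal form of the lattice of
   relations have length at most [excess + 1]. *)
Theorem relations_generated_dstar1 e : uniq e ->
    (forall a, relation_on g e a -> nonneg_vec a -> vec_len a <= dst.+1 -> H a) ->
  forall a, relation_on g e a -> H a.
Proof.
elim: e => [|x t IHt] ue short a ra.
  suff -> : a = 0 by exact: H0.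
  by apply/ffunP => i; rewrite ffunE; apply: (proj1 ra).
have /andP[xt ut] := ue.
have tx : {subset t <= x :: t} by move=> i; rewrite inE orbC => ->.
have Ht c : relation_on g t c -> H c.
  by apply: IHt => // c' rc'; apply: short; apply: relation_onS rc'.
have [b [rb sb nb lb _]] := head_relation x t.
apply: (generated_of_head xt Ht ra rb).
  by rewrite ffunE ffun_mulrnE ffunE eqxx mulr1n natz sb ?addr0.
apply: short => //; first exact: nonneg_basis_head.
rewrite vec_len_basis_head; have [] := excess_dstar ue.
rewrite excess_cons; have := relative_order_gt0 g x t; lia.
Qed.

(** * A minimal family on which relations of length at most [d*] fail to generate *)

Section MinimalFailure.

Variable e0 : seq T.
Hypothesis e0_uniq : uniq e0.
Hypothesis r_gt1 : (1 < r)%N.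
Hypothesis Hsub : forall t, uniq t -> {subset t <= e0} -> (size t < size e0)%N ->
  forall a, relation_on g t a -> H a.
Hypothesis short : forall a, relation_on g e0 a -> nonneg_vec a -> vec_len a <= dst -> H a.
Variable a0 : {ffun T -> int}.
Hypothesis a0_rel : relation_on g e0 a0.
Hypothesis a0_nH : ~ H a0.

Lemma eq_relation_on e e' a : e =i e' -> relation_on g e a -> relation_on g e' a.
Proof. by move=> ee; apply: relation_onS => i; rewrite ee. Qed.

Lemma Hsub_behead x t : perm_eq (x :: t) e0 -> forall a, relation_on g t a -> H a.
Proof.
move=> pe; have ue : uniq (x :: t) by rewrite (perm_uniq pe).
case/andP: (ue) => xt ut; apply: Hsub => // [i it|].
  by rewrite -(perm_mem pe) inE it orbT.
by rewrite -(perm_size pe).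
Qed.

(** If the row headed by [x] were in [H], elimination would put [a0] in [H], since relations on [t]
    are there by minimality. So the row is longer than [d*]; its length being at most the excess
    plus 1, both the excess and the tail are maximal. *)
Lemma ordering_extremal x t : perm_eq (x :: t) e0 ->
  [/\ excess g (x :: t) = dst,
      relation_on g e0 (basis_vec x *+ relative_order g x t + top_vec g t)
    & ~ H (basis_vec x *+ relative_order g x t + top_vec g t)].
Proof.
move=> pe; have ue : uniq (x :: t) by rewrite (perm_uniq pe).
have xt : x \notin t by case/andP: ue.
have em : x :: t =i e0 := perm_mem pe.
have [b [rb sb nb lb eb]] := head_relation x t.
have nHb : ~ H (basis_vec x *+ relative_order g x t + b).
  move=> Hb; apply: a0_nH; apply: (generated_of_head xt (Hsub_behead pe) _ rb _ Hb).
    by apply: (eq_relation_on _ a0_rel) => i; rewrite em.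
  by rewrite ffunE ffun_mulrnE ffunE eqxx mulr1n natz sb ?addr0.
have [leD _] := excess_dstar ue; have c_gt0 := relative_order_gt0 g x t.
have lb' : dst%:Z < (relative_order g x t)%:Z + vec_len b.
  rewrite ltNge; apply/negP => le; apply/nHb/short; first exact: eq_relation_on em rb.
    exact: nonneg_basis_head.
  by rewrite vec_len_basis_head.
have etop : b = top_vec g t by apply: eb; move: leD; rewrite excess_cons; lia.
rewrite -etop; split=> //; last exact: eq_relation_on em rb.
by move: leD; rewrite excess_cons; lia.
Qed.

Lemma relative_order_tail_gt1 x p y t :
  perm_eq (x :: p ++ y :: t) e0 -> (1 < relative_order g y t)%N.
Proof.
move=> pe; have ue : uniq (x :: p ++ y :: t) by rewrite (perm_uniq pe).
have [_ rb nHb] := ordering_extremal pe.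
rewrite ltn_neqAle relative_order_gt0 andbT; apply/negP => /eqP c1; apply: nHb.
have pe' : perm_eq (y :: x :: p ++ t) e0.
  apply: perm_trans pe; rewrite -(cat1s x) -(cat1s x (p ++ y :: t)).
  by rewrite perm_sym !catA -(cat1s y t) perm_catCA.
apply: (Hsub_behead pe'); apply: (@relation_on_behead _ _ _ y).
- by move: e0_uniq; rewrite -(perm_uniq pe') => /andP[].
- by apply: (eq_relation_on _ rb) => i; rewrite (perm_mem pe').
case/andP: ue => xpt upt.
rewrite ffunE ffun_mulrnE ffunE (top_cat_at _ upt) -c1 subnn.
case: eqP => [yx|_]; last by rewrite mul0rn.
by rewrite -yx mem_cat mem_head orbT in xpt.
Qed.

Lemma all_relative_orders_gt1 x p t :
  perm_eq (x :: p ++ t) e0 -> all (ltn 1) (relative_orders g t).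
Proof.
elim: t p => //= y t IHt p pe; rewrite (relative_order_tail_gt1 pe) /=.
by apply: (IHt (rcons p y)); rewrite cat_rcons.
Qed.

(** Every ordering has exactly [r] relative orders above 1. A head order above 1 would make the
    family have [r] elements; but the extremal relation expresses the second element [y] through the
    others, so an ordering headed by [y] has head order 1 and the family has [r + 1] elements. *)
Lemma relative_order_head x t : perm_eq (x :: t) e0 -> relative_order g x t = 1%N.
Proof.
move=> pe; apply/eqP; rewrite eqn_leq relative_order_gt0 andbT leqNgt.
apply/negP => c_gt1.
have sizeE z u : perm_eq (z :: u) e0 ->
    size [seq c <- relative_orders g (z :: u) | 1 < c]%N = r.
  move=> pu; have uu : uniq (z :: u) by rewrite (perm_uniq pu).
  have [_ eqD] := excess_dstar uu; have [eD _ _] := ordering_extremal pu.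
  by rewrite (perm_size (eqD eD)) size_mkseq.
have allE z u : perm_eq (z :: u) e0 ->
    [seq c <- relative_orders g u | 1 < c]%N = relative_orders g u.
  by move=> pu; apply/all_filterP; apply: (@all_relative_orders_gt1 z [::]).
have := sizeE x t pe; rewrite /= c_gt1 (allE x) //= size_relative_orders => sz.
case: t => [|y t] in pe c_gt1 sz *; first by rewrite /= in sz; lia.
have pe' : perm_eq (y :: x :: t) e0.
  by apply: perm_trans pe; rewrite -(cat1s x t) -(cat1s y t) -(cat1s y) -(cat1s x) perm_catCA.
have [_ [_ rb] _] := ordering_extremal pe.
have gy : g y \in span g (x :: t).
  have tx : {subset t <= x :: t} by move=> i; rewrite inE orbC => ->.
  (* The first term is in [span t] by definition of the relative order, the second is in the span of
     the others by the extremal relation. *)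
  have -> : g y = g y *+ relative_order g y t - g y *+ (relative_order g y t - 1).
    by rewrite -mulrnBr ?leq_subr // subKn ?relative_order_gt0.
  apply: spanB; first by rewrite (subsetP (spanS _ tx)) ?mulrn_relative_order.
  move: rb; rewrite !raddfD !raddfMn /= !val_at_basis addrA addrAC.
  move/eqP; rewrite addr_eq0 -spanN => /eqP <-; apply: spanD.
    by rewrite spanMn ?mem_span ?mem_head.
  by apply: (subsetP (spanS _ tx)); apply/val_at_span/supported_top.
have c1 : relative_order g y (x :: t) = 1%N.
  by apply/eqP; rewrite -dvdn1 -relative_order_dvdn mulr1n.
have := sizeE _ _ pe'; have := allE _ _ pe'; rewrite /= c1 /= => -> /=.
by move: sz; rewrite size_relative_orders /=; lia.
Qed.

Lemma size_e0 : size e0 = r.+1.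
Proof.
have : e0 != [::].
  apply: contraPneq a0_nH => e0E; suff -> : a0 = 0 by [].
  by apply/ffunP => i; rewrite ffunE (proj1 a0_rel) // e0E.
case e0E : e0 => [//|x t] _; have pe : perm_eq (x :: t) e0 by rewrite e0E.
have [eD _ _] := ordering_extremal pe.
have ue : uniq (x :: t) by rewrite (perm_uniq pe).
have [_ /(_ eD)/perm_size] := excess_dstar ue.
rewrite size_mkseq /= relative_order_head //=.
rewrite (all_filterP (@all_relative_orders_gt1 x [::] t pe)).
by rewrite size_relative_orders => ->.
Qed.

Lemma minimal_relation x t : perm_eq (x :: t) e0 ->
  relation_on g e0 (basis_vec x + top_vec g t) /\ ~ H (basis_vec x + top_vec g t).
Proof. by move=> pe; have [_] := ordering_extremal pe; rewrite relative_order_head. Qed.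

Lemma minimal_relation_pair x y t : perm_eq (x :: y :: t) e0 ->
  g x + g y *+ (relative_order g y t - 1) \in span g t.
Proof.
move=> /minimal_relation[[_ + _]]; rewrite /= !raddfD raddfMn /= !val_at_basis addrA.
by move/eqP; rewrite addr_eq0 => /eqP->; rewrite spanN; apply/val_at_span/supported_top.
Qed.

Lemma basis_head_at x k b : b x = 0 -> (basis_vec x *+ k + b) x = k%:Z.
Proof. by move=> bx; rewrite ffunE ffun_mulrnE ffunE eqxx mulr1n natz bx addr0. Qed.

Lemma H_eq_head x t a b : perm_eq (x :: t) e0 ->
  relation_on g e0 a -> relation_on g e0 b -> a x = b x -> H b -> H a.
Proof.
move=> pe ra rb ab Hb; rewrite -(subrK b a); apply: closedD => //.
have xt : x \notin t by move: e0_uniq; rewrite -(perm_uniq pe) => /andP[].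
apply/(Hsub_behead pe)/(relation_on_behead xt); last by rewrite !ffunE ab subrr.
by apply: (@eq_relation_on e0) => [i|]; [rewrite (perm_mem pe)|apply: relation_onB].
Qed.

(** The device for building test relations: [a] is prescribed, and the mixed radix expansion of the
    defect fills in the rest on [t]. *)
Lemma complete_relation t a : {subset t <= e0} -> supported e0 a ->
    val_at g a \in span g t ->
  exists b, [/\ relation_on g e0 (a + b), supported t b, nonneg_vec b,
    vec_len b <= excess g t & vec_len b = excess g t -> b = top_vec g t].
Proof.
move=> te sa; rewrite -spanN => /span_rep[b [sb nb vb lb eb]]; exists b; split=> //.
split; last by rewrite raddfD /= vb subrr.
by apply: supportedD => //; apply: supportedS sb.
Qed.

(** The vector with entries 2 at [x] and [c - 2] at [y], completed on the other elements, agrees at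
    [x] with the doubled minimal relation. If the latter were outside [H], so would be the former,
    whose length then forces its completion to be [top_vec]. Comparison with the minimal relation
    gives [g x = g y], which contradicts [relative_order_tail_gt1]. *)
Lemma double_minimal_relation x t : perm_eq (x :: t) e0 ->
  H ((basis_vec x + top_vec g t) *~ 2).
Proof.
move=> pe; have [rb nHb] := minimal_relation pe; have [eD _ _] := ordering_extremal pe.
have sz : size t = r by apply: succn_inj; rewrite -size_e0 -(perm_size pe).
case: t => [|y [|z t]] in eD sz pe rb nHb *; [by move: sz r_gt1 => /= <- ..|].
have ue : uniq (x :: y :: z :: t) by rewrite (perm_uniq pe).
move: ue => /= /and3P[]; rewrite inE negb_or => /andP[xy xzt] yzt uzt.
set t' := z :: t in eD pe rb nHb xzt yzt *; set c := relative_order g y t'.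
have c_gt1 : (1 < c)%N by apply: (@relative_order_tail_gt1 x [::]).
have em : x :: y :: t' =i e0 := perm_mem pe.
apply: NNPP => nH2.
have w_in := minimal_relation_pair pe; rewrite -/c in w_in.
pose u : {ffun T -> int} := basis_vec x *+ 2 + basis_vec y *+ (c - 2).
have su : supported e0 u.
  by rewrite /u !pmulrn; apply: supportedD; apply/supportedMz/supported_basis;
     rewrite -em !inE eqxx ?orbT.
have vu : val_at g u \in span g t'.
  rewrite /u raddfD !raddfMn /= !val_at_basis.
  rewrite (_ : _ + _ = (g x + g y *+ (c - 1)) *+ 2 - g y *+ c).
    by apply: spanB; [apply: spanMn|apply: mulrn_relative_order].
  rewrite mulrnDl -[RHS]addrA -mulrnA -mulrnBr; last by clear -c_gt1; lia.
  by congr (_ + _ *+ _); clear -c_gt1; lia.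
have te : {subset t' <= e0} by move=> i it; rewrite -em in_cons in_cons it !orbT.
have [b [ra sb nb lb eb]] := complete_relation te su vu.
have uxE : (u + b) x = 2.
  by rewrite /u -addrA basis_head_at // ffunE ffun_mulrnE ffunE (negPf xy) mul0rn sb ?addr0.
have nHa : ~ H (u + b).
  move=> Ha; apply: nH2; apply: (H_eq_head pe _ ra _ Ha); first exact: relation_onMz.
  rewrite ffun_mulrzE uxE -[basis_vec x]mulr1n basis_head_at //.
  by apply: (@supported_top _ _ g (y :: t')); rewrite inE negb_or xy.
have la : dst%:Z < vec_len (u + b).
  rewrite ltNge; apply/negP => le; apply: nHa; apply: short => //.
  by rewrite /u -addrA; do 2!apply: nonneg_basis_head.
have btop : b = top_vec g t'.
  apply: eb; move: la; rewrite -eD (excess_cons g x) (excess_cons g y) relative_order_head // -/c.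
  by rewrite /u -addrA !vec_len_basis_head; move: lb c_gt1; clear; lia.
have gxy : g x = g y.
  have [_ va] := ra; have [_ vb'] := rb.
  have : g x *+ 2 + g y *+ (c - 2) = g x + g y *+ (c - 1).
    apply: (addIr (val_at g (top_vec g t'))).
    move: vb' va; rewrite btop /u /= !raddfD raddfMn /= !val_at_basis addrA => ->.
    by rewrite !raddfMn /= !val_at_basis.
  rewrite -/c (_ : c - 1 = 1 + (c - 2))%N; last by clear -c_gt1; lia.
  by rewrite mulrnDr mulr1n addrA => /addIr; rewrite mulr2n => /addrI.
(* The third element [z], available because [r > 1], serves as head, so that [y] stands in the tail
   just before [x]. *)
have pe' : perm_eq (z :: [::] ++ y :: x :: t) e0.
  by apply: perm_trans pe; apply/seq.permP => q /=; clear; lia.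
have := relative_order_tail_gt1 pe'.
have : (relative_order g y (x :: t) %| 1)%N.
  by rewrite -relative_order_dvdn mulr1n -gxy mem_span ?mem_head.
by rewrite dvdn1 => /eqP->.
Qed.

(** Modulo [H] a relation is determined by its entry at [x]; the minimal relation has entry 1 there,
    is outside [H], and its double is inside. *)
Lemma H_iff_even_head x t a : perm_eq (x :: t) e0 -> relation_on g e0 a ->
  H a <-> (2 %| a x)%Z.
Proof.
move=> pe ra; have [rb nHb] := minimal_relation pe.
have H2 := double_minimal_relation pe.
set b := _ + _ in rb nHb H2.
have xt : x \notin t by move: e0_uniq; rewrite -(perm_uniq pe) => /andP[].
have bx : b x = 1 by rewrite /b -[basis_vec x]mulr1n basis_head_at ?supported_top.
have Hev (q : int) : H (b *~ (q * 2)) by rewrite mulrC mulrzA; apply: closedMz.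
split=> [Ha|/dvdzP[q aq]].
  apply/negP => /negP odd_a; apply: nHb.
  have -> : b = b *~ a x - b *~ ((a x %/ 2)%Z * 2).
    rewrite -mulrzBr (_ : _ - _ = 1) ?mulr1z //.
    by move: odd_a; clear; lia.
  apply: HB => //; apply: (H_eq_head pe _ ra _ Ha); first exact: relation_onMz.
  by rewrite ffun_mulrzE bx intz.
apply: (H_eq_head pe ra _ _ (Hev q)); first exact: relation_onMz.
by rewrite ffun_mulrzE bx intz.
Qed.

Lemma H_iff_even x a : x \in e0 -> relation_on g e0 a -> H a <-> (2 %| a x)%Z.
Proof. by move=> xe; apply: (@H_iff_even_head x (rem x e0)); rewrite perm_sym perm_to_rem. Qed.

Lemma same_parity x y a : x \in e0 -> y \in e0 -> relation_on g e0 a ->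
  (2 %| a x)%Z = (2 %| a y)%Z.
Proof.
move=> xe ye ra; apply/idP/idP => /(H_iff_even _ ra) Ha; exact/(H_iff_even _ ra)/Ha.
Qed.

Lemma odd_relation_len x a : x \in e0 -> relation_on g e0 a -> nonneg_vec a ->
  ~~ (2 %| a x)%Z -> dst%:Z < vec_len a.
Proof.
move=> xe ra na odd_a; rewrite ltNge; apply/negP => le.
by move/negP: odd_a; apply; apply/(H_iff_even xe ra); apply: short.
Qed.

(** The Hermite row with pivot at [y] vanishes at [x], so by equal parity its pivot is even. *)
Lemma relative_order_tail_even x p y t :
  perm_eq (x :: p ++ y :: t) e0 -> (2 %| relative_order g y t)%N.
Proof.
move=> pe; have em := perm_mem pe.
have [b [rb sb _ _ _]] := head_relation y t.
have ue : uniq (x :: p ++ y :: t) by rewrite (perm_uniq pe).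
move: ue; rewrite cons_uniq cat_uniq cons_uniq mem_cat inE !negb_or.
move=> /andP[/and3P[xp xy xt] /and3P[_ _ /andP[yt _]]].
have ra : relation_on g e0 (basis_vec y *+ relative_order g y t + b).
  by apply: relation_onS rb => i it; rewrite -em in_cons mem_cat it !orbT.
have xe : x \in e0 by rewrite -em mem_head.
have ye : y \in e0 by rewrite -em in_cons mem_cat mem_head !orbT.
have := same_parity xe ye ra; rewrite basis_head_at ?sb //.
by rewrite ffunE ffun_mulrnE ffunE (negPf xy) mul0rn sb // addr0.
Qed.

(** * Separating relative orders equal to 2 from the larger ones *)

Fixpoint binary_prefix p t :=
  if p is z :: p' then (relative_order g z (p' ++ t) == 2) && binary_prefix p' t else true.

Lemma binary_prefix_rcons p y t t' : t =i y :: t' -> relative_order g y t' = 2%N ->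
  binary_prefix p t -> binary_prefix (rcons p y) t'.
Proof.
move=> tE cy; elim: p => /= [|z p IHp]; first by rewrite cy.
case/andP=> cz /IHp->; rewrite andbT -(eqP cz); apply/eqP/eq_relative_order => i.
by rewrite cat_rcons !mem_cat tE.
Qed.

Lemma eq_binary_prefix p t t' : t =i t' -> binary_prefix p t -> binary_prefix p t'.
Proof.
move=> tE; elim: p => //= z p IHp /andP[cz /IHp->]; rewrite andbT -(eqP cz).
by apply/eqP/eq_relative_order => i; rewrite !mem_cat tE.
Qed.

Lemma binary_prefix_top p t : binary_prefix p t ->
  top_vec g (p ++ t) = \sum_(z <- p) basis_vec z + top_vec g t.
Proof.
elim: p => /= [|z p IHp]; first by rewrite big_nil add0r.
by case/andP=> /eqP-> /IHp->; rewrite mulr1n big_cons addrA.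
Qed.

Lemma binary_prefix_excess p t : binary_prefix p t ->
  excess g (p ++ t) = (size p + excess g t)%N.
Proof. by elim: p => //= z p IHp /andP[/eqP cz /IHp]; rewrite excess_cons cz => ->. Qed.

Lemma binary_prefix_count p t : binary_prefix p t ->
  (count (ltn 2) (relative_orders g (p ++ t)) <= size t)%N.
Proof.
elim: p => /= [_|z p IHp /andP[/eqP-> /IHp]//].
by rewrite -(size_relative_orders g) count_size.
Qed.

(** Greedy choice: an element of order 2 modulo the rest of the tail moves to the end of the prefix,
    where its relative order is taken over exactly that rest. *)
Lemma terminal_ordering : exists x p t,
  [/\ perm_eq (x :: p ++ t) e0, binary_prefix p t
    & forall y, y \in t -> relative_order g y (rem y t) != 2%N].
Proof.
case e0E : e0 => [|x t]; first by have := size_e0; rewrite e0E.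
suff grow k p u : (size u <= k)%N -> perm_eq (x :: p ++ u) e0 -> binary_prefix p u ->
    exists x p t, [/\ perm_eq (x :: p ++ t) e0, binary_prefix p t
      & forall y, y \in t -> relative_order g y (rem y t) != 2%N].
  by rewrite -e0E; apply: (grow (size t) [::] t); rewrite // e0E.
elim: k p u => [|k IHk] p u uk pe bin.
  by exists x, p, u; split=> // y; move: uk; case: (u).
have [/allP stop|/allPn[y yu /negPn/eqP cy]] :=
    boolP (all (fun y => relative_order g y (rem y u) != 2%N) u).
  by exists x, p, u.
have pu := perm_to_rem yu.
apply: (IHk (rcons p y) (rem y u)).
- by rewrite size_rem //; case: (u) uk.
- by apply: perm_trans pe; rewrite cat_rcons perm_cons perm_cat2l perm_sym.
- exact: binary_prefix_rcons (perm_mem pu) cy bin.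
Qed.

Lemma excess_cat_ge x p q u : perm_eq (x :: p ++ q ++ u) e0 ->
  (size q + excess g u <= excess g (q ++ u))%N.
Proof.
elim: q p => //= z q IHq p pe; have := relative_order_tail_gt1 pe.
have := IHq (rcons p z); rewrite cat_rcons => /(_ pe).
by rewrite excess_cons; clear; lia.
Qed.

(** Move [i] to the end of the prefix: the total excess stays [d*], and each other element of the
    prefix except the head still contributes at least 1, which leaves at most 1 for [i]. *)
Lemma relative_order_prefix_le2 x p u i : perm_eq (x :: p ++ u) e0 ->
  binary_prefix p u -> i \in x :: p -> (relative_order g i u <= 2)%N.
Proof.
move=> pe bin ip; have [eD _ _] := ordering_extremal pe.
have pq := perm_to_rem ip; set q := rem i (x :: p) in pq.
have pe' : perm_eq (q ++ i :: u) e0.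
  apply: perm_trans pe; rewrite -cat_cons -cat1s perm_catCA cat1s -cat_cons perm_cat2r.
  by rewrite perm_sym.
have := perm_size pq; case: q pq pe' => [|z q] pq pe'.
  by rewrite (relative_order_head (pe' : perm_eq (i :: u) e0)).
case=> sz'; rewrite cat_cons in pe'; have sz : size p = (size q).+1 := sz'.
have [eD' _ _] := ordering_extremal pe'.
have pe2 : perm_eq (z :: [::] ++ q ++ i :: u) e0 by [].
have : (size q + excess g (i :: u) <= excess g (q ++ i :: u))%N := excess_cat_ge pe2.
move: eD; rewrite -eD'.
rewrite (excess_cons g x) (excess_cons g z) (excess_cons g i).
rewrite (binary_prefix_excess bin) (relative_order_head pe) (relative_order_head pe').
by move: sz; clear; lia.
Qed.

Lemma sum_basis_vec q :
  [/\ supported q (\sum_(z <- q) basis_vec z),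
      nonneg_vec (\sum_(z <- q) basis_vec z),
      vec_len (\sum_(z <- q) basis_vec z) = size q &
      val_at g (\sum_(z <- q) basis_vec z) = \sum_(z <- q) g z].
Proof.
rewrite !raddf_sum /=; split.
- elim: q => [|z q IHq] i; rewrite ?big_nil ?big_cons !ffunE // inE negb_or.
  by case/andP=> /negPf-> /IHq->; rewrite addr0.
- elim: q => [|z q IHq] i; rewrite ?big_nil ?big_cons !ffunE //.
  by rewrite addr_ge0 ?ler0n ?IHq.
- by elim: q => [|z q IHq]; rewrite ?big_nil ?big_cons // vec_len_basis IHq /= intS.
- by apply: eq_bigr => z _; rewrite val_at_basis.
Qed.

(** Modulo the rest of the tail, [2 g i] is [- k g y] with [k] even. For nonzero [k], adding this to
    the minimal relation and removing [c] copies of [y] gives an entry [k - 1] at [y], which is odd,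
    so the completed relation is longer than [d*]. This forces it to differ from the minimal
    relation by [2 g i - 2 g y] only. *)
Lemma double_partner x p t y : perm_eq (x :: p ++ t) e0 -> binary_prefix p t ->
    y \in t -> (2 < relative_order g y (rem y t))%N ->
  exists2 i, i \in x :: p & g i *+ 2 = g y *+ 2.
Proof.
move=> pe0 bin0 yt; set t' := rem y t; set c := relative_order g y t' => c_gt2.
have pt : perm_eq t (y :: t') := perm_to_rem yt.
have pe : perm_eq (x :: p ++ y :: t') e0.
  by apply: perm_trans pe0; rewrite perm_cons perm_cat2l perm_sym.
have bin : binary_prefix p (y :: t') := eq_binary_prefix (perm_mem pt) bin0.
have ue : uniq ((x :: p) ++ y :: t') by rewrite (perm_uniq pe).
move: ue; rewrite cat_uniq => /and3P[_ /hasPn dis /andP[yt' _]].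
have dis_y : y \notin x :: p by apply: dis; rewrite mem_head.
have dis_i i : i \in x :: p -> (i != y) && (i \notin t').
  by move=> ip; rewrite -negb_or -in_cons; apply: contraL ip => /dis.
have em : (x :: p) ++ y :: t' =i e0 := perm_mem pe.
have te : {subset t' <= e0} by move=> i it; rewrite -em mem_cat !in_cons it !orbT.
have pe_in i : i \in x :: p -> i \in e0 by move=> ip; rewrite -em mem_cat ip.
have ye : y \in e0 by rewrite -em mem_cat mem_head orbT.
have even_c : (2 %| c)%N := relative_order_tail_even pe.
have [sS nS lS vS] := sum_basis_vec (x :: p).
set S := \sum_(z <- _) _ in sS nS lS vS; set W := \sum_(z <- _) _ in vS.
have [[_ vb] _] := minimal_relation pe.
have SE : S = basis_vec x + \sum_(z <- p) basis_vec z by rewrite /S big_cons.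
rewrite (binary_prefix_top bin) addrA -SE /= !raddfD raddfMn /= vS in vb.
rewrite val_at_basis -/t' -/c in vb.
have w_in : W + g y *+ (c - 1) \in span g t'.
  move/eqP: vb; rewrite addrA addr_eq0 => /eqP->.
  by rewrite spanN; apply/val_at_span/supported_top.
have [k_of k_ofP] : exists k_of : T -> nat, forall i, i \in x :: p ->
    [/\ (k_of i < c)%N, (2 %| k_of i)%N & g i *+ 2 + g y *+ k_of i \in span g t'].
  suff ex i : exists k, i \in x :: p ->
      [/\ (k < c)%N, (2 %| k)%N & g i *+ 2 + g y *+ k \in span g t'].
    by apply: fin_all_exists ex.
  have [ip|_] := boolP (i \in x :: p); last by exists 0%N.
  have /span_consP[k k_lt] : - (g i *+ 2) \in span g (y :: t').
    rewrite spanN relative_order_dvdn.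
    have := relative_order_prefix_le2 pe bin ip.
    by case: (relative_order g i _) (relative_order_gt0 g i (y :: t')) => [|[|[|]]].
  rewrite -opprD spanN => k_in; exists k => _; split=> //.
  pose u : {ffun T -> int} := basis_vec i *+ 2 + basis_vec y *+ k.
  have su : supported e0 u.
    by rewrite /u !pmulrn; apply: supportedD; apply/supportedMz/supported_basis; [apply: pe_in|].
  have vu : val_at g u \in span g t' by rewrite raddfD !raddfMn /= !val_at_basis.
  have [b [rb sb _ _ _]] := complete_relation te su vu.
  have := same_parity (pe_in i ip) ye rb; have /andP[iy it'] := dis_i i ip.
  rewrite /u -addrA basis_head_at; last by rewrite ffunE ffun_mulrnE ffunE (negPf iy) mul0rn sb.
  by rewrite addrCA basis_head_at // ffunE ffun_mulrnE ffunE eq_sym (negPf iy) mul0rn sb.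
(* If every [2 g i] were in [span t'], doubling the minimal relation would give that [c] divides
   [2 (c - 1)], hence divides 2. *)
have [/allP all_in|/allPn[i ip ni]] := boolP (all (fun i => g i *+ 2 \in span g t') (x :: p)).
  have W2 : W *+ 2 \in span g t'.
    rewrite /W -sumrMnl; rewrite big_seq; elim/big_ind: _ => //; first exact: span0.
    exact: spanD.
  have := spanB (spanMn 2 w_in) W2.
  rewrite mulrnDl addrAC subrr add0r -mulrnA relative_order_dvdn -/c => dvd_c.
  have c2 : ((c - 1) * 2 + 2 = c * 2)%N by clear -c_gt2; lia.
  have : (c %| 2)%N by rewrite -(dvdn_addr 2 dvd_c) c2 dvdn_mulr.
  by move/(@dvdn_leq _ 2 isT); rewrite leqNgt c_gt2.
have [k_lt k_even k_in] := k_ofP i ip; set k := k_of i in k_lt k_even k_in.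
have k_gt1 : (1 < k)%N.
  rewrite ltnNge; apply: contra ni => k_le1; move: k_in.
  by rewrite (_ : k = 0%N) ?addr0 //; clear -k_le1 k_even; lia.
exists i => //; have /andP[iy it'] := dis_i i ip.
pose u := S + (basis_vec i *+ 2 + basis_vec y *+ (k - 1)).
have su : supported e0 u.
  rewrite /u !pmulrn; apply: supportedD; first exact: supportedS sS.
  by apply: supportedD; apply/supportedMz/supported_basis; [apply: pe_in|].
have vu : val_at g u \in span g t'.
  rewrite /u !raddfD !raddfMn /= !val_at_basis vS.
  rewrite (_ : _ + _ = (W + g y *+ (c - 1)) + (g i *+ 2 + g y *+ k) - g y *+ c).
    by apply: spanB; [apply: spanD|apply: mulrn_relative_order].
  rewrite addrACA -[RHS]addrA [LHS]addrA; congr (_ + _).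
  by rewrite -mulrnDr -mulrnBr; [congr (_ *+ _)|]; clear -c_gt2 k_gt1; lia.
have [b [ra sb nb lb eb]] := complete_relation te su vu.
have odd_a : ~~ (2 %| (u + b)%R y)%Z.
  rewrite /u !ffunE !ffun_mulrnE !ffunE eqxx (sS y dis_y) (eq_sym y) (negPf iy) sb //.
  by rewrite /= mulr0n mulr1n !add0r addr0 natz; clear -k_even k_gt1; lia.
have na : nonneg_vec (u + b).
  move=> j; rewrite /u -addrA ffunE addr_ge0 //.
  by rewrite -addrA; do 2!apply: nonneg_basis_head.
have [eD _ _] := ordering_extremal pe.
have := odd_relation_len ye ra na odd_a.
rewrite -eD excess_cons (relative_order_head pe) (binary_prefix_excess bin) excess_cons -/c.
rewrite /u -addrA vec_lenD lS -addrA !vec_len_basis_head /= => len_a.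
(* Both [k] and [c] are even, so [k + 2 <= c]; the lower bound on the length then leaves no slack in
   this estimate or in that of [b]. *)
have btop : b = top_vec g t' by apply: eb; clear -len_a lb k_lt k_gt1 k_even even_c; lia.
have kc : (k = c - 2)%N by clear -len_a lb k_lt k_gt1 k_even even_c; lia.
have [_ va] := ra.
have : W + (g i *+ 2 + g y *+ (k - 1)) = W + g y *+ (c - 1).
  apply: (addIr (val_at g (top_vec g t'))).
  move: vb va; rewrite btop /u /= [X in X = _ -> _]addrA => ->.
  by rewrite !raddfD !raddfMn /= !val_at_basis vS.
move/addrI; rewrite kc (_ : c - 1 = 2 + (c - 2 - 1))%N; last by clear -c_gt2; lia.
by rewrite mulrnDr => /addIr.
Qed.

(** Doubling is injective on the terminal tail, as a coincidence would give relative order at most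
    2. With the partners, [size t <= size p + 1], so [2 * size t <= r + 1 <= 2 * s + 1]; yet the at
    least [s + 1] orders above 2 all sit in [t]. *)
Lemma minimal_failure_absurd (s : nat) : (s < r)%N -> (r <= 2 * s)%N ->
  (forall i, i <= s -> 2 < n i)%N -> False.
Proof.
move=> s_r r_s n_gt2; have [x [p [t [pe bin stop]]]] := terminal_ordering.
have em := perm_mem pe.
have t_gt2 y : y \in t -> (2 < relative_order g y (rem y t))%N.
  move=> yt; have pe' : perm_eq (x :: p ++ y :: rem y t) e0.
    by apply: perm_trans pe; rewrite perm_cons perm_cat2l perm_sym perm_to_rem.
  by have := relative_order_tail_gt1 pe'; have := stop y yt; clear; lia.
have ut : uniq t.
  by move: e0_uniq; rewrite -(perm_uniq pe) -cat_cons cat_uniq => /and3P[].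
have u2 : uniq [seq g y *+ 2 | y <- t].
  rewrite map_inj_in_uniq // => y y' yt y't E; apply/eqP/idPn => yy'.
  have : g y *+ 2 \in span g (rem y t).
    by rewrite E spanMn ?mem_span // (mem_rem_uniq _ ut) inE eq_sym yy'.
  rewrite relative_order_dvdn => /(@dvdn_leq _ 2 isT).
  by rewrite leqNgt t_gt2.
have sub2 : {subset [seq g y *+ 2 | y <- t] <= [seq g i *+ 2 | i <- x :: p]}.
  move=> _ /mapP[y yt ->]; have [i ip <-] := double_partner pe bin yt (t_gt2 y yt).
  exact: (map_f (fun z => g z *+ 2) ip).
have := uniq_leq_size u2 sub2; rewrite !size_map.
have := perm_size pe; rewrite size_e0 /= size_cat => -[sz'].
have sz : (size p + size t)%N = r := sz'.
have ue : uniq (x :: p ++ t) by rewrite (perm_uniq pe).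
have [eD _ _] := ordering_extremal pe; have [_ /(_ eD) cs] := excess_dstar ue.
have count_n : (s < count (ltn 2) (mkseq n r))%N.
  rewrite -(subnKC s_r) /mkseq iotaD map_cat count_cat (leq_trans _ (leq_addr _ _)) //.
  rewrite count_map (@eq_in_count _ _ xpredT) ?count_predT ?size_iota // => i.
  by rewrite mem_iota add0n ltnS => /andP[_ /n_gt2 /= ->].
have : (count (ltn 2) (mkseq n r) <= size t)%N.
  rewrite -(seq.permP cs) count_filter (leq_trans _ (binary_prefix_count bin)) //=.
  rewrite (relative_order_head pe) /=.
  by apply: sub_count => c /= /andP[].
by move: sz count_n r_s => /=; clear; lia.
Qed.

End MinimalFailure.

Theorem relations_generated_dstar e (s : nat) : uniq e -> (s < r)%N -> (r <= 2 * s)%N ->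
    (forall i, i <= s -> 2 < n i)%N ->
    (forall a, relation_on g e a -> nonneg_vec a -> vec_len a <= dst -> H a) ->
  forall a, relation_on g e a -> H a.
Proof.
move=> + s_r r_s n_gt2; have [k] := ubnP (size e).
elim: k e => // k IHk e ek ue short a ra; apply: NNPP => nHa.
have r_gt1 : (1 < r)%N by move: s_r r_s; clear; lia.
apply: (@minimal_failure_absurd e ue r_gt1 _ short a ra nHa s s_r r_s n_gt2) => t ut te tsz.
apply: IHk => // [|c rc]; first by move: ek tsz; clear; lia.
by apply: short; apply: relation_onS rc.
Qed.

End ShortRelations.

(** * Tuples of residues *)

Section CyclicCoordinates.

Variables (T : finType) (r N : nat) (m : 'I_r -> nat) (X : T -> 'I_r -> nat).

Hypothesis N_gt1 : (1 < N)%N.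
Hypothesis m_dvdN : forall l, (m l %| N)%N.
Hypothesis m_gt1 : forall l, (1 < m l)%N.
Hypothesis m_dvd : forall i j : 'I_r, (i <= j)%N -> (m j %| m i)%N.

(* The group of the tuples of residues mod [m l], with the [l]-th summand
   embedded in [Z/N]; the element attached to [i] has coordinates [X i]. *)
Definition cyclic_coords (i : T) : 'rV['Z_N]_r := \row_l (X i l * (N %/ m l))%:R.

(** The value 1 from [r] on stands for trivial summands, so that families with more than [r]
    elements obey the same bound. *)
Definition pad_orders (l : nat) : nat := if insub l is Some i then m i else 1%N.

Lemma pad_ordersE (l : 'I_r) : pad_orders l = m l.
Proof. by rewrite /pad_orders valK. Qed.

Lemma pad_orders1 l : (r <= l)%N -> pad_orders l = 1%N.
Proof. by move=> rl; rewrite /pad_orders insubF // ltnNge rl. Qed.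

Lemma pad_orders_gt1 l : (l < r)%N -> (1 < pad_orders l)%N.
Proof. by move=> lr; rewrite (pad_ordersE (Ordinal lr)). Qed.

Lemma pad_orders_gt0 l : (0 < pad_orders l)%N.
Proof. by rewrite /pad_orders; case: insubP => // i _ _; apply: ltnW. Qed.

Lemma pad_orders_dvd k l : (k <= l)%N -> (pad_orders l %| pad_orders k)%N.
Proof.
move=> kl; case: (ltnP l r) => [lr|/pad_orders1->]; last exact: dvd1n.
rewrite (pad_ordersE (Ordinal lr)) (pad_ordersE (Ordinal (leq_ltn_trans kl lr))).
exact: m_dvd.
Qed.

Lemma Zp_natr_eq0 k : ((k%:R : 'Z_N) == 0) = (N %| k)%N.
Proof. by rewrite -val_eqE /= val_Zp_nat. Qed.

Lemma sum_cyclic_coords (I : finType) (e : I -> T) (a : I -> nat) l :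
  (\sum_i cyclic_coords (e i) *+ a i) ord0 l =
  ((\sum_i a i * X (e i) l) * (N %/ m l))%:R.
Proof.
rewrite summxE big_distrl /= natr_sum; apply: eq_bigr => i _.
by rewrite mulmxnE mxE -mulrnA; congr (_%:R); lia.
Qed.

Lemma cyclic_coords_eq0 (a : T -> nat) :
  val_at cyclic_coords [ffun i => (a i)%:Z] = 0 <->
  forall l, (m l %| \sum_i a i * X i l)%N.
Proof.
have -> : val_at cyclic_coords [ffun i => (a i)%:Z] = \sum_i cyclic_coords i *+ a i.
  by apply: eq_bigr => i _; rewrite ffunE -pmulrn.
have q_gt0 l : (0 < N %/ m l)%N.
  by rewrite divn_gt0 ?(ltnW (m_gt1 l)) // dvdn_leq // ltnW.
have dvdE l k : (N %| k * (N %/ m l))%N = (m l %| k)%N.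
  by rewrite -[RHS](dvdn_pmul2r (q_gt0 l)) [(m l * _)%N]mulnC divnK.
split=> [/rowP a0 l|a0].
  by rewrite -dvdE -Zp_natr_eq0 -(sum_cyclic_coords id a) a0 mxE.
by apply/rowP => l; apply/eqP; rewrite (sum_cyclic_coords id a) mxE Zp_natr_eq0 dvdE.
Qed.

(** The left side counts the parameters of a span of [k] elements: [k] coefficients modulo
    [pad_orders k], and a multiple of [pad_orders k] in each of the first [k] summands. *)
Lemma prod_pad_orders k :
  (pad_orders k ^ k * \prod_(l < r) (if l < k then pad_orders l %/ pad_orders k else 1) =
   \prod_(l < k) pad_orders l)%N.
Proof.
set M := pad_orders k; pose F l := (if l < k then pad_orders l %/ M else 1)%N.
have -> : (\prod_(l < r) F l = \prod_(l < k + r) F l)%N.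
  rewrite -!(big_mkord xpredT F) [RHS](big_cat_nat (leq0n _) (leq_addl k r)) /=.
  rewrite [X in (_ * X)%N]big_nat_cond [X in (_ * X)%N]big1 ?muln1 // => l.
  rewrite andbT /F => /andP[rl _]; case: ifP => // lk.
  by rewrite /M !pad_orders1 // (leq_trans rl) // ltnW.
have -> : (\prod_(l < k + r) F l = \prod_(l < k) (pad_orders l %/ M))%N.
  rewrite -(big_mkord xpredT F) (big_cat_nat (leq0n _) (leq_addr r k)) /=.
  rewrite [X in (_ * X)%N]big_nat_cond [X in (_ * X)%N]big1 ?muln1 => [|l].
    by rewrite big_mkord; apply: eq_bigr => l _; rewrite /F ltn_ord.
  by rewrite andbT /F => /andP[kl _]; rewrite ltnNge kl.
rewrite -{1}(card_ord k) -prod_nat_const -big_split /=.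
by apply: eq_bigr => l _; rewrite mulnC divnK // pad_orders_dvd // ltnW.
Qed.

(* Reducing coefficients modulo [M], the order following the first [k], leaves
   multiples of [M], which live in the first [k] cyclic factors. *)
Lemma card_span_cyclic_coords (e : seq T) : uniq e ->
  (#|span cyclic_coords e| <= \prod_(l < size e) pad_orders l)%N.
Proof.
move=> ue; set k := size e; rewrite -prod_pad_orders; set M := pad_orders k.
pose B (l : 'I_r) := (if l < k then pad_orders l %/ M else 1)%N.
pose idx (j : 'I_k) := tnth (in_tuple e) j.
pose F (u : {ffun 'I_k -> 'I_M} * {dffun forall l, 'I_(B l)}) : 'rV['Z_N]_r :=
  \sum_j cyclic_coords (idx j) *+ u.1 j + \row_l (u.2 l * (M * (N %/ m l)))%:R.
have M_gt0 : (0 < M)%N := pad_orders_gt0 k.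
have B_gt0 l : (0 < B l)%N.
  rewrite /B; case: ifP => // lk; rewrite divn_gt0 //.
  by rewrite dvdn_leq ?pad_orders_gt0 // pad_orders_dvd // ltnW.
have N_dvd l : (N %| B l * (M * (N %/ m l)))%N.
  rewrite mulnA /B; case: ltnP => lk.
    by rewrite divnK ?pad_orders_dvd 1?ltnW // pad_ordersE mulnC divnK.
  rewrite mul1n -{1}(divnK (m_dvdN l)) mulnC dvdn_mul //.
  by rewrite -(pad_ordersE l) pad_orders_dvd.
have -> : (M ^ k * \prod_(l < r) B l)%N =
    #|{: {ffun 'I_k -> 'I_M} * {dffun forall l, 'I_(B l)}}|.
  rewrite card_prod card_ffun !card_ord card_dep_ffun foldrE big_image /=.
  by congr (_ * _)%N; apply: eq_bigr => l _; rewrite card_ord.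
rewrite -cardsT; apply: leq_trans (leq_imset_card F _).
apply/subset_leq_card/subsetP => z /spanP[a sa <-].
have N0 (v : 'rV['Z_N]_r) : v *+ N = 0.
  apply/rowP => l; rewrite mulmxnE mxE -mulr_natr (_ : N%:R = 0) ?mulr0 //.
  by apply/eqP; rewrite Zp_natr_eq0.
pose b i := absz (a i %% N)%Z.
have zE : val_at cyclic_coords a = \sum_j cyclic_coords (idx j) *+ b (idx j).
  transitivity (\sum_(i in e) cyclic_coords i *+ b i).
    rewrite /val_at (bigID (mem e)) /= [X in _ + X]big1 ?addr0 => [|i ie]; last first.
      by rewrite sa // mulr0z.
    apply: eq_bigr => i _; rewrite {1}(divz_eq (a i) N) mulrzDr mulrzA mulrzAC.
    rewrite -[_ *~ N]pmulrn N0 mul0rz add0r pmulrn; congr (_ *~ _).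
    by rewrite /b gez0_abs // modz_ge0 //; lia.
  by rewrite -big_uniq //= big_tnth.
(* Coefficients are divided by [M]: the remainders [rho] are kept, while the quotients matter only
   through the coordinates [Q] of their combination, reduced modulo [B]. *)
pose rho : {ffun 'I_k -> 'I_M} := [ffun j => Ordinal (ltn_pmod (b (idx j)) M_gt0)].
pose Q l := (\sum_j (b (idx j) %/ M) * X (idx j) l)%N.
pose t : {dffun forall l, 'I_(B l)} := [ffun l => Ordinal (ltn_pmod (Q l) (B_gt0 l))].
apply/imsetP; exists (rho, t) => //; rewrite zE; apply/rowP => l.
rewrite /F [RHS]mxE !sum_cyclic_coords mxE ffunE /= -natrD.
have -> : (\sum_j b (idx j) * X (idx j) l =
    Q l * M + \sum_j rho j * X (idx j) l)%N.
  rewrite /Q big_distrl -big_split /=; apply: eq_bigr => j _.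
  by rewrite {1}(divn_eq (b (idx j)) M) ffunE /=; lia.
rewrite {1}(divn_eq (Q l) (B l)).
rewrite (_ : (_ + _) * _ = (Q l %/ B l) * (B l * (M * (N %/ m l))) +
  ((\sum_j rho j * X (idx j) l) * (N %/ m l) + Q l %% B l * (M * (N %/ m l))))%N; last by lia.
rewrite natrD -[RHS]add0r; congr (_ + _).
by apply/eqP; rewrite Zp_natr_eq0 dvdn_mull.
Qed.

End CyclicCoordinates.

(** * Monomial invariants of a diagonalized module *)

Lemma closed_field_prim_root (F : closedFieldType) k :
  k%:R != 0 :> F -> exists z : F, k.-primitive_root z.
Proof.
move=> k0; have k_gt0 : (0 < k)%N by case: k k0 => //; rewrite eqxx.
have [rs rsE] := closed_field_poly_normal ('X^k - 1 : {poly F}).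
rewrite (monicP _) ?monicXnsubC // scale1r in rsE.
have rs1 : all k.-unity_root rs by apply/allP=> z; rewrite -root_prod_XsubC -rsE.
have sz : (k < (size rs).+1)%N by rewrite -(size_prod_XsubC rs id) -rsE size_XnsubC.
have [|z] := hasP (has_prim_root k_gt0 rs1 _ sz); last by exists z.
by rewrite -separable_prod_XsubC -rsE separable_Xn_sub_1.
Qed.

Section Diagonalization.

Variables (F : closedFieldType) (gT : finGroupType) (G : {group gT}).
Hypotheses (abG : abelian G) (charG : #|G|%:R != 0 :> F).

(** The matrix is a root of [X^#|G| - 1], which splits with simple roots. *)
Lemma diagonalizable_repr n (rG : mx_representation F G n) g : g \in G ->
  diagonalizable (rG g).
Proof.
case: n rG => [|n] rG gG; first by rewrite [rG g]thinmx0; apply: diagonalizable0.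
have [z z_prim] := closed_field_prim_root charG.
apply/diagonalizableP; exists [seq z ^+ i | i <- index_iota 0 #|G|].
  rewrite map_inj_in_uniq ?iota_uniq // => i j.
  rewrite !mem_index_iota => iG jG /eqP.
  by rewrite (eq_prim_root_expr z_prim) !modn_small // => /eqP.
rewrite big_map (factor_Xn_sub_1 z_prim) mxminpoly_min //.
rewrite rmorphB rmorphXn /= horner_mx_X rmorph1 -repr_mxX // expg_cardG //.
by rewrite repr_mx1 subrr.
Qed.

Lemma abelian_repr_diag n (rG : mx_representation F G n) :
  exists2 P : 'M[F]_n, P \in unitmx & exists chi : 'I_n -> gT -> F,
    forall g, g \in G -> P *m rG g = diag_mx (\row_i chi i g) *m P.
Proof.
have [|P Pu /allP dP] := proj1 (@codiagonalizableP F n [seq rG g | g <- enum G]).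
  split=> [_ _ /mapP[g + ->] /mapP[h + ->]|_ /mapP[g + ->]]; rewrite !mem_enum.
    by move=> gG hG; rewrite /comm_mx -!repr_mxM // (centsP abG).
  exact: diagonalizable_repr.
exists P => //; exists (fun i g => conjmx P (rG g) i i) => g gG.
have := dP (rG g); rewrite map_f ?mem_enum // => /(_ isT) /=.
case/diagonalizable_forPex=> D /(simmxP Pu) PE; rewrite PE; congr (_ *m _).
have -> : conjmx P (rG g) = diag_mx D by apply/eqP; apply/(simmxP Pu).
by congr diag_mx; apply/rowP => i; rewrite !mxE eqxx mulr1n.
Qed.

End Diagonalization.

Section DiagonalModule.

Variables (F : fieldType) (gT : finGroupType) (G : {group gT}).
Variables (n : nat) (rG : mx_representation F G n) (P : 'M[F]_n) (chi : 'I_n -> gT -> F).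
Hypotheses (charG : #|G|%:R != 0 :> F) (Pu : P \in unitmx).
Hypothesis diagE : forall g, g \in G -> P *m rG g = diag_mx (\row_i chi i g) *m P.

Implicit Types (a : 'I_n -> nat) (v : 'cV[F]_n).

Definition char_monomial a (g : gT) : F := \prod_i chi i g ^+ a i.
Definition invariant_exponent a := [forall g in G, char_monomial a g == 1].
Definition monomial_at a v : F := \prod_i v i 0 ^+ a i.

Lemma mulmx_repr_diag g v i : g \in G ->
  (P *m (rG g *m v)) i 0 = chi i g * (P *m v) i 0.
Proof. by move=> gG; rewrite mulmxA diagE // -mulmxA mul_diag_mx !mxE. Qed.

Lemma diag_charM i g h : g \in G -> h \in G -> chi i (g * h)%g = chi i g * chi i h.
Proof.
move=> gG hG; have := diagE (groupM gG hG).
rewrite repr_mxM // mulmxA diagE // -mulmxA diagE // mulmxA.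
move/(can_inj (mulmxK Pu))/matrixP/(_ i i).
by rewrite mul_diag_mx !mxE eqxx !mulr1n => ->.
Qed.

Lemma char_monomialM a g h : g \in G -> h \in G ->
  char_monomial a (g * h)%g = char_monomial a g * char_monomial a h.
Proof.
move=> gG hG; rewrite -big_split; apply: eq_bigr => i _ /=.
by rewrite diag_charM // exprMn.
Qed.

(** Orthogonality: translating the sum by some [h] of nontrivial weight multiplies it by that
    weight. *)
Lemma sum_char_monomial a :
  \sum_(g in G) char_monomial a g = if invariant_exponent a then #|G|%:R else 0.
Proof.
case: ifPn => [/forall_inP inv_a|].
  by rewrite -sumr_const; apply: eq_bigr => g /inv_a/eqP.
case/forall_inPn=> h hG h1; apply/eqP.
have := erefl (\sum_(g in G) char_monomial a g).
rewrite {1}(reindex_inj (mulgI h)) /=.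
rewrite (eq_bigl (mem G)) => [|g]; last by rewrite /= groupMl.
rewrite (eq_bigr (fun g => char_monomial a h * char_monomial a g)); last first.
  by move=> g gG; rewrite char_monomialM.
rewrite -mulr_sumr => /eqP; rewrite -subr_eq0 -[X in _ - X]mul1r -mulrBl mulf_eq0.
by rewrite subr_eq0 (negPf h1).
Qed.

Lemma monomial_at_diag a g v : g \in G ->
  monomial_at a (P *m (rG g *m v)) = char_monomial a g * monomial_at a (P *m v).
Proof.
move=> gG; rewrite -big_split; apply: eq_bigr => i _ /=.
by rewrite mulmx_repr_diag // exprMn.
Qed.

Lemma pt_evalE (q : {mpoly F[n]}) v :
  pt_eval q v = \sum_(m <- msupp q) q@_m * monomial_at m v.
Proof. exact: mevalE. Qed.

(* Averaging over [G] kills the monomials with a nontrivial weight. *)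
Lemma invariant_expansion (h q : {mpoly F[n]}) : Defs.invariant rG h ->
    (forall v, pt_eval h v = pt_eval q (P *m v)) ->
  forall v, pt_eval h v =
    \sum_(m <- msupp q | invariant_exponent m) q@_m * monomial_at m (P *m v).
Proof.
move=> inv_h hq v; apply: (mulfI charG).
transitivity (\sum_(g in G) pt_eval h (rG g *m v)).
  by rewrite mulr_natl -sumr_const; apply: eq_bigr => g gG; rewrite inv_h.
under eq_bigr => g gG.
  rewrite hq pt_evalE; under eq_bigr do rewrite monomial_at_diag //.
  over.
rewrite exchange_big /= mulr_sumr [RHS]big_mkcond /=; apply: eq_bigr => m _.
rewrite (eq_bigr (fun g => q@_m * monomial_at m (P *m v) * char_monomial m g)).
  by rewrite -mulr_sumr sum_char_monomial; case: ifP; rewrite ?mulr0 // mulrC.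
by move=> g _; rewrite mulrCA mulrC.
Qed.

(** A monomial in the eigencoordinates [P *m v], rewritten in the original coordinates; the linear
    substitution preserves its degree. *)
Definition monomial_poly a : {mpoly F[n]} :=
  \prod_i (\sum_j P i j *: 'X_j) ^+ a i.

Lemma pt_eval_monomial_poly a v : pt_eval (monomial_poly a) v = monomial_at a (P *m v).
Proof.
rewrite /pt_eval /monomial_poly rmorph_prod /=; apply: eq_bigr => i _.
rewrite rmorphXn /= raddf_sum mxE /=; congr (_ ^+ _); apply: eq_bigr => j _.
by rewrite mevalZ mevalXU.
Qed.

Lemma monomial_poly_homog a : monomial_poly a \is (\sum_i a i).-homog.
Proof.
rewrite /monomial_poly; elim/big_ind2: _ => [|d1 p1 d2 p2|i _]; first exact: dhomog1.
  exact: dhomogM.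
rewrite -[a i in X in X.-homog]mul1n; apply: dhomogMn.
by apply: rpred_sum => j _; apply: dhomogZ; rewrite dhomogX /= mdeg1.
Qed.

Lemma monomial_poly_invariant a : invariant_exponent a ->
  Defs.invariant rG (monomial_poly a).
Proof.
move=> /forall_inP inv_a v g gG.
by rewrite !pt_eval_monomial_poly monomial_at_diag // (eqP (inv_a g gG)) mul1r.
Qed.

End DiagonalModule.

(** * From generation of relations to separation of points, and back *)

Section Separation.

Variables (F : fieldType) (gT : finGroupType) (G : {group gT}).
Variables (n : nat) (rG : mx_representation F G n) (chi : 'I_n -> gT -> F).
Hypothesis charG : #|G|%:R != 0 :> F.

(** By the bound on orders, pure powers of eigencoordinates are available and show that both points
    vanish at the same places. On the common support generation applies to the ratios; a monomial
    involving another coordinate is 0 at both points. *)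
Lemma separated_of_generation (P : 'M[F]_n) (A : finZmodType) (g : 'I_n -> A) (d : nat) :
    P \in unitmx ->
    (forall x, x \in G -> P *m rG x = diag_mx (\row_i chi i x) *m P) ->
    (forall a : 'I_n -> nat,
       val_at g [ffun i => (a i)%:Z] = 0 <-> invariant_exponent G chi a) ->
    (forall i, relative_order g i [::] <= d)%N ->
    (forall (H : {ffun 'I_n -> int} -> Prop) e,
       H 0 -> (forall a b, H a -> H b -> H (a - b)) -> uniq e ->
       (forall a, relation_on g e a -> nonneg_vec a -> vec_len a <= d -> H a) ->
       forall a, relation_on g e a -> H a) ->
  separated_in_degree rG d.
Proof.
move=> Pu diagE g_inv ord_le gen.
exists (fun f => Defs.invariant rG f /\ exists2 e, (e <= d)%N & f \is e.-homog); last first.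
  by move=> f [].
split=> [f []//|v w agree h inv_h].
set u := P *m v; set u' := P *m w.
have short a : invariant_exponent G chi a -> (\sum_i a i <= d)%N ->
    monomial_at a u = monomial_at a u'.
  move=> inv_a le_a; rewrite -!pt_eval_monomial_poly; apply: agree.
  split; first exact: monomial_poly_invariant diagE _ inv_a.
  by exists (\sum_i a i)%N => //; apply: monomial_poly_homog.
have supp i : (u i 0 == 0) = (u' i 0 == 0).
  set k := relative_order g i [::].
  have k_gt0 : (0 < k)%N := relative_order_gt0 g i [::].
  pose a (j : 'I_n) := if j == i then k else 0%N.
  have monE z : monomial_at a z = z i 0 ^+ k.
    rewrite /monomial_at (bigD1 i) //= /a eqxx big1 ?mulr1 // => j /negPf->.
    by rewrite expr0.
  have inv_a : invariant_exponent G chi a.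
    apply/g_inv; rewrite /val_at (bigD1 i) //= ffunE /a eqxx big1 ?addr0 => [|j /negPf ji].
      have := mulrn_relative_order g i [::]; rewrite -/k.
      case/spanP=> b sb; rewrite /val_at big1 => [|j _]; last by rewrite sb ?mulr0z.
      by rewrite -pmulrn => <-.
    by rewrite ffunE ji mulr0z.
  have le_a : (\sum_j a j <= d)%N.
    rewrite (bigD1 i) //= /a eqxx big1 ?addn0 ?ord_le // => j /negPf->.
    by [].
  have := short a inv_a le_a; rewrite !monE => /(congr1 (eq_op^~ 0)).
  by rewrite !expf_eq0 k_gt0.
pose e := enum [pred i | u i 0 != 0].
(* The ratios are nonzero on [e], so negative exponents make sense and [H] is closed under
   subtraction. *)
pose H (b : {ffun 'I_n -> int}) := \prod_(i <- e) (u i 0 / u' i 0) ^ b i = 1.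
have ratio0 i : i \in e -> u i 0 / u' i 0 != 0.
  by rewrite mem_enum inE => ui; rewrite mulf_neq0 ?invr_eq0 -?supp.
have HE (a : 'I_n -> nat) : (forall i, i \notin e -> a i = 0%N) ->
    H [ffun i => (a i)%:Z] <-> monomial_at a u = monomial_at a u'.
  move=> sa; rewrite /H.
  have -> : \prod_(i <- e) (u i 0 / u' i 0) ^ ([ffun i => (a i)%:Z] i) =
      (\prod_(i <- e) u i 0 ^+ a i) / \prod_(i <- e) u' i 0 ^+ a i.
    rewrite -prodf_div; apply: eq_bigr => i _; rewrite ffunE -exprnP expr_div_n //.
  have monE z : monomial_at a z = \prod_(i <- e) z i 0 ^+ a i.
    rewrite big_uniq ?enum_uniq //= /monomial_at (bigID (mem e)) /=.
    by rewrite [X in _ * X]big1 ?mulr1 // => i /sa->; rewrite expr0.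
  have nz : \prod_(i <- e) u' i 0 ^+ a i != 0.
    rewrite prodf_seq_neq0; apply/allP => i; rewrite mem_enum inE => ui.
    by rewrite /= expf_neq0 // -supp.
  rewrite !monE; split=> [/(canRL (mulfVK nz))|->]; last exact: divff.
  by rewrite mul1r.
have absE (b : {ffun 'I_n -> int}) : nonneg_vec b -> [ffun i => (absz (b i))%:Z] = b.
  by move=> nb; apply/ffunP => i; rewrite ffunE gez0_abs.
have all_mon a : invariant_exponent G chi a -> monomial_at a u = monomial_at a u'.
  move=> inv_a; have [/forallP sa|/forallPn[i]] := boolP [forall i, (i \notin e) ==> (a i == 0%N)].
    have sa' i : i \notin e -> a i = 0%N by move=> /(implyP (sa i))/eqP.
    apply/(HE a sa'); apply: (gen H e); rewrite ?enum_uniq //.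
    - by rewrite /H big1 // => i _; rewrite ffunE expr0z.
    - move=> b c; rewrite /H => Hb Hc.
      rewrite big_seq (eq_bigr (fun i => (u i 0 / u' i 0) ^ b i / (u i 0 / u' i 0) ^ c i)).
        by rewrite -big_seq prodf_div Hb Hc divr1.
      by move=> i ie; rewrite !ffunE expfzDr ?ratio0 // invr_expz.
    - move=> b [sb vb] nb lb; rewrite -(absE b nb).
      apply/HE => [i ie|]; first by rewrite sb.
      apply: short; first by apply/g_inv; rewrite absE.
      have : vec_len [ffun i => (absz (b i))%:Z] <= d by rewrite absE.
      rewrite /vec_len (eq_bigr (fun i => (absz (b i))%:R)); last by move=> i _; rewrite ffunE natz.
      by rewrite -natr_sum natz.
    - split=> [i ie|]; first by rewrite ffunE sa'.
      exact/g_inv.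
  rewrite negb_imply => /andP[ie ai]; have ui : u i 0 == 0 by move: ie; rewrite mem_enum inE negbK.
  rewrite /monomial_at (bigD1 i) //= [RHS](bigD1 i) //= (eqP ui).
  by move: (ui); rewrite supp => /eqP->; rewrite expr0n (negPf ai) !mul0r.
pose q := h \mPo [tuple \sum_j invmx P i j *: 'X_j | i < n].
have hq z : pt_eval h z = pt_eval q (P *m z).
  rewrite /pt_eval comp_mpoly_meval; apply: meval_eq => i.
  rewrite tnth_mktuple raddf_sum /= -{1}(mulKmx Pu z) mxE; apply: eq_bigr => j _.
  by rewrite mevalZ mevalXU.
rewrite !(invariant_expansion charG Pu diagE inv_h hq); apply: eq_bigr => b inv_b.
by congr (_ * _); apply: all_mon.
Qed.

(* The points [(1, ..., 1)] and [(1, ..., theta, ..., 1)] agree on every short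
   invariant monomial. *)
Lemma separated_lower_bound (d D : nat) (theta : F) (i0 : 'I_n) (a : 'I_n -> nat) :
    (forall x, x \in G -> rG x = diag_mx (\row_i chi i x)) ->
    (forall b : 'I_n -> nat, invariant_exponent G chi b -> theta ^+ b i0 != 1 ->
       (D <= \sum_i b i)%N) ->
    invariant_exponent G chi a -> theta ^+ a i0 != 1 ->
  separated_in_degree rG d -> (D <= d)%N.
Proof.
move=> diagE long inv_a a1 [S [inv_S sep] deg_S]; rewrite leqNgt; apply/negP => d_lt.
have P1 : (1%:M : 'M[F]_n) \in unitmx by apply: unitmx1.
have diagE1 x : x \in G -> 1%:M *m rG x = diag_mx (\row_i chi i x) *m 1%:M.
  by move=> xG; rewrite mul1mx mulmx1 diagE.
pose v : 'cV[F]_n := const_mx 1.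
pose w : 'cV[F]_n := \col_i (if i == i0 then theta else 1).
have mon_v b : monomial_at b v = 1.
  by rewrite /monomial_at big1 // => i _; rewrite mxE expr1n.
have mon_w b : monomial_at b w = theta ^+ b i0.
  rewrite /monomial_at (bigD1 i0) //= mxE eqxx big1 ?mulr1 // => i /negPf i_i0.
  by rewrite mxE i_i0 expr1n.
have eq_vw : forall h, Defs.invariant rG h -> pt_eval h v = pt_eval h w.
  apply: sep => f Sf; have inv_f := inv_S f Sf; have [e e_d hom_f] := deg_S f Sf.
  have fq z : pt_eval f z = pt_eval f (1%:M *m z) by rewrite mul1mx.
  rewrite !(invariant_expansion charG P1 diagE1 inv_f fq) !mul1mx.
  rewrite big_seq_cond [RHS]big_seq_cond; apply: eq_bigr => b /andP[bf inv_b].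
  congr (_ * _); rewrite mon_v mon_w; apply/esym/eqP/negPn/negP => b1.
  have := long b inv_b b1; have := dhomog_mf hom_f bf; rewrite /= mdegE => ->.
  by rewrite leqNgt (leq_ltn_trans e_d).
have := eq_vw _ (monomial_poly_invariant diagE1 inv_a).
by rewrite !pt_eval_monomial_poly !mul1mx mon_v mon_w => /esym/eqP; rewrite (negPf a1).
Qed.

End Separation.

(** Classical reasoning, because separation in a given degree comes with no decision procedure. *)
Lemma exists_least (Q : nat -> Prop) (b : nat) : Q b ->
  exists2 m, Q m /\ (forall k, Q k -> m <= k)%N & (m <= b)%N.
Proof.
elim/ltn_ind: b => b IHb Qb.
have [[k [kb Qk]]|nk] := classic (exists k, (k < b)%N /\ Q k).
  by have [m Qm mk] := IHb k kb Qk; exists m => //; apply: leq_trans mk (ltnW kb).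
exists b => //; split=> // k Qk; rewrite leqNgt; apply/negP => kb.
by apply: nk; exists k.
Qed.

Lemma beta_sep_ubound_of_separated (F : fieldType) (gT : finGroupType) (G : {group gT})
    (b : nat) : (0 < b)%N ->
    (forall n (rG : mx_representation F G n), separated_in_degree rG b) ->
  beta_sep_ubound F G b.
Proof.
move=> b_gt0 sep n rG.
have [d [[d_gt0 sep_d] min_d] db] :=
  @exists_least (fun e => (0 < e)%N /\ separated_in_degree rG e) b (conj b_gt0 (sep n rG)).
by exists d => //; split=> // e e_gt0 sep_e; apply: min_d.
Qed.

Lemma val_Zp_add (p : nat) (x y : 'Z_p) : (1 < p)%N -> (x + y)%R = (x + y)%N %[mod p].
Proof. by case: p x y => [|[|p]] //= x y _; rewrite modn_mod. Qed.

(** Coordinates are natural representatives of residues, hence additive only modulo [m l]; the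
    generators correspond to the unit vectors. *)
Lemma isog_cyclic_coordinates (gT : finGroupType) (G : {group gT}) (r : nat) (m : 'I_r -> nat) :
    (forall i, 1 < m i)%N ->
    (G \isog [set: {dffun forall i : 'I_r, 'Z_(m i)}])%g ->
  #|G| = (\prod_i m i)%N /\
  exists (c : 'I_r -> gT -> nat) (gen : 'I_r -> gT),
    [/\ forall l, gen l \in G, G \subset <<[set gen l | l : 'I_r]>>%g,
        forall l, (gen l ^+ m l = 1)%g,
        forall l, {in G &, forall g h, c l (g * h)%g = c l g + c l h %[mod m l]}
      & forall l k, c l (gen k) = (l == k)].
Proof.
move=> m_gt1 isoG; split.
  rewrite (card_isog isoG) cardsT card_dep_ffun foldrE big_image /=.
  by apply: eq_bigr => i _; rewrite card_ord Zp_cast.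
have [f inj_f im_f] := isogP isoG.
have gen_ex l : exists2 x, x \in G & f x = dfung1 (1%R : 'Z_(m l)).
  have : dfung1 (1%R : 'Z_(m l)) \in (f @* G)%g by rewrite im_f inE.
  by case/morphimP=> x _ xG ->; exists x.
have [gen genG f_gen] := fin_all_exists2 gen_ex.
exists (fun l g => f g l : nat), gen; split=> // [|l|l g h gG hG|l k].
- apply/subsetP => g gG.
  suff : f g \in (f @* <<[set gen l | l : 'I_r]>>)%g.
    case/morphimP=> h hG h_in /(injmP inj_f)-> //.
  have -> : f g = (\prod_l dfung1 (f g l))%g.
    apply/ffunP => i; rewrite prodg_ffun (big_only1 i) ?dfung1_id//.
    by move=> j ij _; rewrite dfung1_dflt.
  apply: group_prod => l _.
  have -> : dfung1 (f g l) = f (gen l ^+ (f g l : nat))%g.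
    rewrite morphX // f_gen -morphX ?inE //; congr dfung1.
    by rewrite FinRing.zmodXgE natr_Zp.
  apply: mem_morphim; first by rewrite groupX.
  by rewrite groupX // mem_gen // imset_f.
- apply: (injmP inj_f); rewrite ?groupX ?group1 // morphX // f_gen -morphX ?inE //.
  rewrite FinRing.zmodXgE morph1; apply: etrans (morph1 _).
  by congr dfung1; apply/eqP; rewrite Zp_natr_eq0.
- by rewrite morphM // ffunE FinRing.zmodMgE val_Zp_add.
rewrite f_gen; case: eqVneq => [->|lk]; first by rewrite dfung1_id.
by rewrite dfung1_dflt // eq_sym.
Qed.

Lemma isog_prim_roots (F : closedFieldType) (gT : finGroupType) (G : {group gT})
    (r : nat) (m : 'I_r -> nat) :
    #|G|%:R != 0 :> F -> (forall i, 1 < m i)%N ->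
    (G \isog [set: {dffun forall i : 'I_r, 'Z_(m i)}])%g ->
  exists zeta : 'I_r -> F, forall l, (m l).-primitive_root (zeta l).
Proof.
move=> charG m_gt1 isoG; have [cardG _] := isog_cyclic_coordinates m_gt1 isoG.
suff ex l : exists z : F, (m l).-primitive_root z by exact: (fin_all_exists ex).
apply: closed_field_prim_root; apply: contraNneq charG => ml0.
by rewrite cardG (bigD1 l) //= natrM ml0 mul0r.
Qed.

Section InvariantExponents.

Variables (F : fieldType) (gT : finGroupType) (G : {group gT}).
Variables (n : nat) (rG : mx_representation F G n) (P : 'M[F]_n) (chi : 'I_n -> gT -> F).
Hypothesis Pu : P \in unitmx.
Hypothesis diagE : forall g, g \in G -> P *m rG g = diag_mx (\row_i chi i g) *m P.
Variables (r : nat) (m : 'I_r -> nat) (gen : 'I_r -> gT) (zeta : 'I_r -> F).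
Hypotheses (genG : forall l, gen l \in G) (sG : G \subset <<[set gen l | l : 'I_r]>>%g).
Hypothesis zeta_prim : forall l, (m l).-primitive_root (zeta l).

Lemma diag_char1 i : chi i 1%g = 1.
Proof.
have := diagE (group1 G); rewrite repr_mx1 mulmx1 -[LHS]mul1mx.
by move/(can_inj (mulmxK Pu))/matrixP/(_ i i); rewrite !mxE eqxx !mulr1n => <-.
Qed.

Lemma diag_charX i g k : g \in G -> chi i (g ^+ k)%g = chi i g ^+ k.
Proof.
move=> gG; elim: k => [|k IHk]; first by rewrite expg0 expr0 diag_char1.
by rewrite expgS exprS (diag_charM Pu diagE) ?groupX // IHk.
Qed.

Lemma diag_char_exponents : (forall l, gen l ^+ m l = 1)%g ->
  exists X : 'I_n -> 'I_r -> nat, forall i l, chi i (gen l) = zeta l ^+ X i l.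
Proof.
move=> gen_m; suff ex i : exists Xi : 'I_r -> nat, forall l, chi i (gen l) = zeta l ^+ Xi l.
  exact: (fin_all_exists ex).
suff exl l : exists k : nat, chi i (gen l) = zeta l ^+ k by exact: (fin_all_exists exl).
have := diag_charX i (m l) (genG l); rewrite gen_m diag_char1 => /esym.
by case/(prim_rootP (zeta_prim l)) => k ->; exists k.
Qed.

(** The elements on which a weight is trivial form a subgroup, so generators suffice; there the
    weight is a power of a primitive root. *)
Lemma invariant_exponentP (X : 'I_n -> 'I_r -> nat) (a : 'I_n -> nat) :
    (forall i l, chi i (gen l) = zeta l ^+ X i l) ->
  invariant_exponent G chi a <-> forall l, (m l %| \sum_i a i * X i l)%N.
Proof.
move=> XE; have genE l : char_monomial chi a (gen l) = zeta l ^+ (\sum_i a i * X i l).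
  rewrite -prodrXr; apply: eq_bigr => i _; rewrite XE -exprM mulnC //.
split=> [/forall_inP inv_a l|dvd_a].
  by rewrite (prim_order_dvd (zeta_prim l)) -genE inv_a.
pose K := [set g in G | char_monomial chi a g == 1].
have gK : group_set K.
  apply/group_setP; split=> [|g h].
    by rewrite inE group1 /char_monomial big1 ?eqxx // => i _; rewrite diag_char1 expr1n.
  rewrite !inE => /andP[gG /eqP g1] /andP[hG /eqP h1].
  by rewrite groupM // (char_monomialM Pu diagE) // g1 h1 mulr1 /=.
have GK : G \subset Group gK.
  apply: subset_trans sG _; rewrite gen_subG; apply/subsetP => _ /imsetP[l _ ->].
  by rewrite inE genG genE -(prim_order_dvd (zeta_prim l)) dvd_a.
by apply/forall_inP => g /(subsetP GK); rewrite inE => /andP[].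
Qed.

End InvariantExponents.

Lemma sum_pad_orders (r : nat) (m : 'I_r -> nat) :
  (\sum_(i < r) (pad_orders m i - 1))%N = dstar m.
Proof. by apply: eq_bigr => i _; rewrite pad_ordersE. Qed.

Lemma separated_of_relations (F : closedFieldType) (gT : finGroupType) (G : {group gT})
    (r : nat) (m : 'I_r -> nat) (d : nat) :
    abelian G -> #|G|%:R != 0 :> F -> (forall i, 1 < m i)%N ->
    (forall i j : 'I_r, (i <= j)%N -> (m j %| m i)%N) ->
    (G \isog [set: {dffun forall i : 'I_r, 'Z_(m i)}])%g ->
    (pad_orders m 0 <= d)%N ->
    (forall (A : finZmodType) (T : finType) (g : T -> A),
       (forall e, uniq e -> #|span g e| <= \prod_(i < size e) pad_orders m i)%N ->
       forall H : {ffun T -> int} -> Prop, H 0 ->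
       (forall a b, H a -> H b -> H (a - b)) -> forall e, uniq e ->
       (forall a, relation_on g e a -> nonneg_vec a -> vec_len a <= d -> H a) ->
       forall a, relation_on g e a -> H a) ->
  forall n (rG : mx_representation F G n), separated_in_degree rG d.
Proof.
move=> abG charG m_gt1 m_dvd isoG d_ge gen_rel n rG.
have [cardG [c [gen [genG sG gen_m _ _]]]] := isog_cyclic_coordinates m_gt1 isoG.
have [zeta zeta_prim] := isog_prim_roots charG m_gt1 isoG.
have [P Pu [chi diagE]] := abelian_repr_diag abG charG rG.
have [X XE] := diag_char_exponents Pu diagE genG zeta_prim gen_m.
(* The factor 2 ensures [1 < N] even for the trivial group. *)
pose N := (2 * #|G|)%N.
have N_gt1 : (1 < N)%N by rewrite /N; have := cardG_gt0 G; clear; lia.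
have m_dvdN l : (m l %| N)%N by rewrite dvdn_mull // cardG (bigD1 l) //= dvdn_mulr.
have card_sp := card_span_cyclic_coords X N_gt1 m_dvdN m_gt1 m_dvd.
apply: (separated_of_generation charG Pu diagE (g := cyclic_coords N m X)).
- move=> a; rewrite (invariant_exponentP Pu diagE genG sG zeta_prim a XE).
  exact: cyclic_coords_eq0.
- move=> i; apply: leq_trans d_ge; have := card_sp [:: i] isT.
  rewrite big_ord1; apply: leq_trans.
  apply: leq_trans (card_span_cons _ _ _); rewrite leq_pmulr // cardG_gt0 //.
- by move=> H e H0 HB ue short; apply: (gen_rel _ _ _ card_sp H H0 HB e ue short).
Qed.

Lemma beta_sep_ubound_dstar1 (F : closedFieldType) (gT : finGroupType) (G : {group gT})
    (r : nat) (m : 'I_r -> nat) :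
    abelian G -> #|G|%:R != 0 :> F -> (forall i, 1 < m i)%N ->
    (forall i j : 'I_r, (i <= j)%N -> (m j %| m i)%N) ->
    (G \isog [set: {dffun forall i : 'I_r, 'Z_(m i)}])%g ->
  beta_sep_ubound F G (dstar m + 1).
Proof.
move=> abG charG m_gt1 m_dvd isoG; apply: beta_sep_ubound_of_separated; first by rewrite addn1.
apply: (separated_of_relations abG charG m_gt1 m_dvd isoG).
  case: r m m_gt1 {m_dvd isoG} => [|r] m m_gt1; first by rewrite pad_orders1 ?addn1.
  rewrite -sum_pad_orders big_ord_recl /=; have := pad_orders_gt0 m_gt1 0; clear; lia.
move=> A T g card_sp H H0 HB e ue short.
apply: (relations_generated_dstar1 (pad_orders_gt1 m_gt1) (@pad_orders1 r m) card_sp H0 HB ue).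
by rewrite sum_pad_orders -addn1.
Qed.

Lemma beta_sep_ubound_dstar (F : closedFieldType) (gT : finGroupType) (G : {group gT})
    (r : nat) (m : 'I_r -> nat) (s : nat) :
    abelian G -> #|G|%:R != 0 :> F -> (forall i, 1 < m i)%N ->
    (forall i j : 'I_r, (i <= j)%N -> (m j %| m i)%N) ->
    (G \isog [set: {dffun forall i : 'I_r, 'Z_(m i)}])%g ->
    (s < r)%N -> (r <= 2 * s)%N -> (2 < pad_orders m s)%N ->
  beta_sep_ubound F G (dstar m).
Proof.
move=> abG charG m_gt1 m_dvd isoG s_r r_s m_s.
(* Rank at least 2 is used here: the second summand contributes at least 1 to [dstar m]. *)
have d_ge : (pad_orders m 0 <= dstar m)%N.
  have r_gt1 : (1 < r)%N by move: s_r r_s; clear; lia.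
  rewrite -sum_pad_orders -(big_mkord xpredT (fun i => pad_orders m i - 1)%N).
  rewrite big_ltn ?(ltnW r_gt1) // big_ltn //.
  have := pad_orders_gt1 m_gt1 r_gt1; have := pad_orders_gt0 m_gt1 0; clear; lia.
apply: beta_sep_ubound_of_separated.
  by apply: leq_trans d_ge; apply: pad_orders_gt0.
apply: (separated_of_relations abG charG m_gt1 m_dvd isoG d_ge).
move=> A T g card_sp H H0 HB e ue short.
apply: (relations_generated_dstar (pad_orders_gt1 m_gt1) (@pad_orders1 r m) card_sp H0 HB ue s_r r_s).
  move=> i i_s; apply: leq_trans m_s _; rewrite dvdn_leq ?pad_orders_gt0 //.
  exact: pad_orders_dvd.
by rewrite sum_pad_orders.
Qed.

(** * Extremal modules *)

(* The exponents of the variables [0 .. r] with weights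
   [e_i] (i < s), [e_(i - s) + e_i] (s <= i < 2s), and, at [r], the sum of all
   [e_l] (s <= l) added to the previous weight (if any). *)
Definition extremal_weight (r s : nat) (i : 'I_r.+1) (l : 'I_r) : nat :=
  ((i == l :> nat) + (i == (if l < s then s + l else r) :> nat))%N.

(** Each coordinate [l] involves just two variables, [l] and a partner. If [r + 1 = 2 * s], the
    partner of [s - 1] is already the last variable [r]. *)
Lemma sum_extremal_weight (r s : nat) (l : 'I_r) (b : nat -> nat) :
    (r + 1 = 2 * s)%N \/ (r = 2 * s)%N ->
  (\sum_(i < r.+1) b i * extremal_weight s i l =
   b l + b (if l < s then s + l else r))%N.
Proof.
move=> rs; have ltl := ltn_ord l.
have pick k : (k < r.+1)%N -> (\sum_(i < r.+1) b i * (i == k :> nat) = b k)%N.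
  move=> kr; rewrite (bigD1 (Ordinal kr)) //= eqxx muln1 big1 ?addn0 // => i.
  by rewrite -val_eqE /= => /negPf->; rewrite muln0.
rewrite /extremal_weight (eq_bigr _ (fun i _ => mulnDr _ _ _)) big_split /=.
rewrite !pick //; last by apply: ltnW.
by case: ifP => // ls; move: rs ltl ls; clear; lia.
Qed.

Lemma dstar_tail2 (r : nat) (m : 'I_r -> nat) (s : nat) :
    (r + 1 = 2 * s)%N \/ (r = 2 * s)%N -> (forall i, 1 < m i)%N ->
    (forall i : 'I_r, s <= i -> m i = 2)%N ->
  (dstar m + 1 = \sum_(i < s) pad_orders m i + (r.+1 - 2 * s))%N.
Proof.
move=> rs m_gt1 m2; have s_r : (s <= r)%N by move: rs; clear; lia.
rewrite -sum_pad_orders -!(big_mkord xpredT (fun i => pad_orders m i - 1)%N).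
rewrite (big_cat_nat (leq0n _) s_r) /=.
rewrite [X in (_ + X + 1)%N](eq_big_nat _ _ (F2 := fun=> 1%N)) => [|i /andP[si ir]]; last first.
  by rewrite (pad_ordersE m (Ordinal ir)) m2.
rewrite sum_nat_const_nat muln1 big_mkord.
have -> : (\sum_(i < s) pad_orders m i = \sum_(i < s) (pad_orders m i - 1) + s)%N.
  rewrite -[X in (_ + X)%N](card_ord s) -sum1_card -big_split /=.
  by apply: eq_bigr => i _; rewrite subnK ?pad_orders_gt0.
by move: rs; clear; lia.
Qed.

(** For [l >= s] the modulus is 2, so an odd exponent at [r] forces an odd one at [l]. Then each of
    the [s] disjoint pairs [l], [s + l] has a positive sum divisible by [m l], and for [r = 2 * s]
    the unpaired last variable adds at least 1. *)
Lemma extremal_length (r : nat) (m : 'I_r -> nat) (s : nat) (b : nat -> nat) :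
    (r + 1 = 2 * s)%N \/ (r = 2 * s)%N -> (forall i, 1 < m i)%N ->
    (forall i : 'I_r, s <= i -> m i = 2)%N ->
    (forall l : 'I_r, m l %| b l + b (if l < s then s + l else r))%N ->
    (0 < b r)%N -> (s < r -> odd (b r))%N ->
  (dstar m + 1 <= \sum_(i < r.+1) b i)%N.
Proof.
move=> rs m_gt1 m2 dvd_b br_gt0 br_odd; rewrite (dstar_tail2 rs m_gt1 m2).
have b_gt0 j : (s <= j)%N -> (j <= r)%N -> (0 < b j)%N.
  rewrite [(j <= r)%N]leq_eqVlt => sj /predU1P[->//|jr].
  have := dvd_b (Ordinal jr); rewrite m2 //= ltnNge sj /= dvdn2 oddD.
  by rewrite (br_odd (leq_ltn_trans sj jr)) addbT negbK => /odd_gt0.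
rewrite -(big_mkord xpredT b) (big_cat_nat (n := 2 * s)) //=; last by move: rs; clear; lia.
apply: leq_add; last first.
  rewrite -[X in (X <= _)%N]muln1 -sum_nat_const_nat big_nat_cond [X in (_ <= X)%N]big_nat_cond.
  apply: leq_sum => i /andP[/andP[si ir] _].
  by apply: b_gt0 => //; move: si; clear; lia.
have s2 : (s <= 2 * s)%N by clear; lia.
have -> : (\sum_(0 <= i < 2 * s) b i = \sum_(0 <= i < s) b i + \sum_(0 <= i < s) b (i + s))%N.
  rewrite (big_cat_nat (leq0n s) s2) /=; congr (_ + _)%N.
  by rewrite -{1}[s]add0n big_addn (_ : 2 * s - s = s)%N //; clear; lia.
rewrite -big_split /= big_mkord; apply: leq_sum => l _.
have lr : (l < r)%N by have := ltn_ord l; move: rs; clear; lia.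
rewrite (pad_ordersE m (Ordinal lr)); apply: dvdn_leq.
  rewrite addn_gt0 (b_gt0 (l + s)%N) ?orbT //; first exact: leq_addl.
  by have := ltn_ord l; move: rs; clear; lia.
by have := dvd_b (Ordinal lr); rewrite /= ltn_ord addnC [(l + s)%N]addnC addnC.
Qed.

Lemma beta_sep_lower_bound (F : closedFieldType) (gT : finGroupType) (G : {group gT})
    (r : nat) (m : 'I_r -> nat) (s c : nat) :
    #|G|%:R != 0 :> F -> (forall i, 1 < m i)%N ->
    (G \isog [set: {dffun forall i : 'I_r, 'Z_(m i)}])%g ->
    (r + 1 = 2 * s)%N \/ (r = 2 * s)%N ->
    (forall i : 'I_r, s <= i -> m i = 2)%N -> (0 < r)%N ->
  beta_sep_ubound F G c -> (dstar m + 1 <= c)%N.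
Proof.
move=> charG m_gt1 isoG rs m2 r_gt0 ub.
have [cardG [coord [gen [genG sG gen_m coordM coord_gen]]]] :=
  isog_cyclic_coordinates m_gt1 isoG.
have [zeta zeta_prim] := isog_prim_roots charG m_gt1 isoG.
pose X := @extremal_weight r s.
pose chi i g := \prod_l zeta l ^+ (X i l * coord l g).
have chiM i : {in G &, {morph chi i : g h / (g * h)%g >-> g * h}}.
  move=> g h gG hG; rewrite -big_split; apply: eq_bigr => l _ /=.
  rewrite -exprD -mulnDr !(mulnC (X i l)) !exprM; congr (_ ^+ _).
  by apply/eqP; rewrite (eq_prim_root_expr (zeta_prim l)) coordM.
have chi_gen i l : chi i (gen l) = zeta l ^+ X i l.
  rewrite /chi (bigD1 l) //= coord_gen eqxx muln1 big1 ?mulr1 // => k /negPf kl.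
  by rewrite coord_gen kl muln0.
have chi_n0 i g : chi i g != 0.
  apply/prodf_neq0 => l _; rewrite expf_neq0 //.
  apply/eqP => z0; have /eqP := prim_expr_order (zeta_prim l).
  by rewrite z0 expr0n eqn0Ngt (ltnW (m_gt1 l)) eq_sym oner_eq0.
have chi1 i : chi i 1%g = 1.
  by apply: (mulfI (chi_n0 i 1%g)); rewrite mulr1 -chiM ?group1 ?mulg1.
have rG_repr : mx_repr G (fun g => diag_mx (\row_i chi i g)).
  split=> [|g h gG hG]; apply/matrixP => i j.
    by rewrite !mxE chi1.
  by rewrite mul_diag_mx !mxE chiM // mulrnAr.
pose rG := MxRepresentation rG_repr.
have [d [_ sep_d _] dc] := ub r.+1 rG; apply: leq_trans dc.
have P1 : (1%:M : 'M[F]_r.+1) \in unitmx by apply: unitmx1.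
have diagE x : x \in G -> 1%:M *m rG x = diag_mx (\row_i chi i x) *m 1%:M.
  by move=> xG; rewrite mul1mx mulmx1.
have rp : (r.-1 < r)%N by rewrite ltn_predL.
(* The last root of unity tests the last variable: if [s < r] it has order 2, so it detects exactly
   the odd exponents. *)
pose lz := Ordinal rp.
have invP (b : nat -> nat) :
    invariant_exponent G chi (fun i => b i) <->
    forall l : 'I_r, (m l %| b l + b (if l < s then s + l else r))%N.
  rewrite (invariant_exponentP P1 diagE genG sG zeta_prim _ chi_gen).
  by split=> dvd_b l; have := dvd_b l; rewrite sum_extremal_weight.
(* Each variable and its partner have exponents summing to exactly [m l], while the last exponent is
   1, so the point is detected. *)
pose a j := (if j < s then pad_orders m j - 1 else 1)%N.
have s_r : (s <= r)%N by move: rs r_gt0; clear; lia.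
have odd_tail : (s < r)%N -> m lz = 2%N by move=> sr; apply: m2; move: sr; clear; rewrite /=; lia.
apply: (@separated_lower_bound _ _ G _ rG chi charG d _ (zeta lz) ord_max
  (fun i => a i)) sep_d => //.
- move=> b inv_b b1.
  pose b' j := b (inord j).
  have bE : b =1 fun i => b' i by move=> i; rewrite /b' inord_val.
  rewrite (eq_bigr _ (fun i _ => bE i)).
  have inv_b' : invariant_exponent G chi (fun i => b' i).
    move: inv_b; rewrite /invariant_exponent /char_monomial => /forall_inP inv_b.
    apply/forall_inP => g gG; rewrite (eq_bigr (fun i => chi i g ^+ b i)) ?inv_b // => i _.
    by rewrite -bE.
  have {}b1 : ~~ (m lz %| b' r)%N by rewrite (prim_order_dvd (zeta_prim lz)) -(bE ord_max).
  apply: (extremal_length rs m_gt1 m2); first exact/invP.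
    by rewrite lt0n; apply: contraNneq b1 => ->; rewrite dvdn0.
  by move=> sr; move: b1; rewrite odd_tail // dvdn2 negbK.
- apply/invP => l; rewrite /a; case: (ltnP l s) => ls.
    by rewrite ltnNge leq_addr /= subnK ?pad_orders_gt0 // pad_ordersE.
  by rewrite ltnNge s_r /= m2.
rewrite /a /= ltnNge s_r /= -(prim_order_dvd (zeta_prim lz)) dvdn1.
by have := m_gt1 lz; case: eqP => // ->.
Qed.

(** The first order [m l0] is an exponent of [G], so it bounds the order of a cyclic [G], whereas
    two summands give at least [m l0 * m l1]. *)
Lemma isog_cyclic_rank_le1 (gT : finGroupType) (G : {group gT}) (r : nat) (m : 'I_r -> nat) :
    (forall i, 1 < m i)%N -> (forall i j : 'I_r, (i <= j)%N -> (m j %| m i)%N) ->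
    (G \isog [set: {dffun forall i : 'I_r, 'Z_(m i)}])%g ->
  cyclic G -> (r <= 1)%N.
Proof.
move=> m_gt1 m_dvd isoG cycG; rewrite leqNgt; apply/negP => r_gt1.
have [cardG [_ [gen [genG sG gen_m _ _]]]] := isog_cyclic_coordinates m_gt1 isoG.
have r_gt0 := ltnW r_gt1; pose l0 := Ordinal r_gt0; pose l1 := Ordinal r_gt1.
pose K := [set x in G | x ^+ m l0 == 1]%g.
have gK : group_set K.
  apply/group_setP; split=> [|x y]; first by rewrite inE group1 expg1n eqxx.
  rewrite !inE => /andP[xG /eqP x1] /andP[yG /eqP y1].
  have cxy : commute x y by apply: (centsP (cyclic_abelian cycG)).
  by rewrite groupM //= expgMn // x1 y1 mulg1.
have GK : G \subset Group gK.
  apply: subset_trans sG _; rewrite gen_subG; apply/subsetP => _ /imsetP[l _ ->].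
  rewrite inE genG /=; have /dvdnP[q ->] : (m l %| m l0)%N by apply: m_dvd.
  by rewrite mulnC expgM gen_m expg1n.
have [x Gx] := cyclicP cycG; have xG : x \in G by rewrite Gx cycle_id.
have : (#|G| %| m l0)%N.
  by move: (subsetP GK x xG); rewrite inE xG /= -order_dvdn [in X in _ -> X]Gx.
move/(dvdn_leq (ltnW (m_gt1 l0))); rewrite leqNgt => /negP; apply.
rewrite cardG (bigD1 l0) //= (bigD1 l1) //= mulnA.
have q_gt0 : (0 < \prod_(i < r | (i != l0) && (i != l1)) m i)%N.
  by rewrite prodn_cond_gt0 // => i _; apply: ltnW.
apply: leq_trans (leq_pmulr _ q_gt0).
by rewrite ltn_Pmulr ?m_gt1 // ltnW.
Qed.

Theorem theorem3p10
  (F : closedFieldType) (gT : finGroupType) (G : {group gT})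
  (abG : abelian G) (charG : ([pchar F]%R^'.-group G)%g)
  (r : nat) (m : 'I_r -> nat)
  (m_gt1 : forall i : 'I_r, (1 < m i)%N)
  (m_dvd : forall i j : 'I_r, (i <= j)%N -> (m j %| m i)%N)
  (isoG : (G \isog [set: {dffun forall i : 'I_r, 'Z_(m i)}])%g)
  (s : nat) (rs : (r + 1 = 2 * s)%N \/ (r = 2 * s)%N) :
  exists b : nat,
    [/\ is_beta_sep F G b,
        (b <= dstar m + 1)%N &
        b = (dstar m + 1)%N <->
        cyclic G \/ (forall i : 'I_r, (s <= i)%N -> m i = 2%N)].
Proof.
have G0 : #|G|%:R != 0 :> F by rewrite natf_neq0_pchar.
have ub1 := beta_sep_ubound_dstar1 abG G0 m_gt1 m_dvd isoG.
have [b [ub min_b] b_le] := exists_least ub1.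
exists b; split=> //.
(* A cyclic group has [r <= 1], and then no index satisfies [s <= i], so both alternatives reduce to
   the condition on the tail. *)
have tail2 : cyclic G \/ (forall i : 'I_r, (s <= i)%N -> m i = 2%N) ->
    forall i : 'I_r, (s <= i)%N -> m i = 2%N.
  case=> // /(isog_cyclic_rank_le1 m_gt1 m_dvd isoG) r1 i si.
  by exfalso; have := ltn_ord i; move: r1 rs si; clear; lia.
split=> [bE|/tail2 m2]; last first.
  apply/eqP; rewrite eqn_leq b_le /=; have [r0|r_gt0] := posnP r; last first.
    exact: (beta_sep_lower_bound G0 m_gt1 isoG rs m2 r_gt0 ub).
  (* For the trivial group the target is 1, and the zero module already requires a positive
     degree. *)
  have triv : mx_repr G (fun=> 1%:M : 'M[F]_0).
    by split=> // g h _ _; rewrite mul1mx.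
  have [d [d_gt0 _ _] db] := ub 0%N (MxRepresentation triv).
  rewrite /dstar big1 ?add0n ?(leq_trans d_gt0) // => i.
  by have := ltn_ord i; rewrite {2}r0.
right=> i si; apply: NNPP => mi.
have ir := ltn_ord i; have s_r := leq_ltn_trans si ir.
have m_s : (2 < pad_orders m s)%N.
  have mi3 : (2 < m i)%N by have := m_gt1 i; move: mi; clear; lia.
  apply: leq_trans mi3 _; rewrite -pad_ordersE dvdn_leq ?pad_orders_gt0 //.
  exact: pad_orders_dvd.
have r_s : (r <= 2 * s)%N by move: rs; clear; lia.
have := min_b _ (beta_sep_ubound_dstar abG G0 m_gt1 m_dvd isoG s_r r_s m_s).
by rewrite bE addn1 ltnn.
Qed.
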